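(* Let $q$ be an odd prime power. Then: (1) if $q^2-q+1$ is prime, then $PSU_3(q)$ has a minimal logarithmic signature; (2) if $q > 5$ and $q+1 = 2p$ for some prime $p$, then $PSU_3(q)$ has a minimal logarithmic signature.
   Context: All groups are finite. For a finite group $G$, a logarithmic signature of $G$ is an ordered tuple $[A_1,\ldots,A_s]$ of subsets $A_i \subseteq G$ such that every element $g \in G$ can be written uniquely as a product $g = a_1a_2\cdots a_s$ with $a_i \in A_i$ for each $i$. Its length is $\sum_{i=1}^s |A_i|$. If $|G| = p_1^{\beta_1}\cdots p_k^{\beta_k}$ with $p_1,\ldots,p_k$ distinct primes and $\beta_j \ge 1$, every logarithmic signature has length at least $\sum_{j=1}^k \beta_j p_j$, and a logarithmic signature is called minimal (an MLS) if its length equals $\sum_{j=1}^k \beta_j p_j$. $PSU_3(q)$ is the projective special unitary group $SU_3(q)/Z(SU_3(q))$, where $SU_3(q)$ is the special unitary group of dimension $3$ over $GF(q^2)$. *)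

(* Defs.v *)
From HB Require Import structures.
From mathcomp Require Import all_boot all_order all_algebra all_fingroup all_solvable all_field.
Set Implicit Arguments. Unset Strict Implicit. Unset Printing Implicit Defensive.
Import GRing.Theory.
Local Open Scope group_scope.

Fixpoint prod_count (gT : finGroupType) (s : seq {set gT}) (g : gT) : nat :=
  match s with
  | [::] => (g == 1)
  | A :: s' => (\sum_(a in A) prod_count s' (a^-1 * g))%N
  end.

Definition is_log_sig (gT : finGroupType) (G : {set gT}) (s : seq {set gT}) : Prop :=
  (forall A, A \in s -> A \subset G) /\
  (forall g, g \in G -> prod_count s g = 1%N).

Definition ls_length (gT : finGroupType) (s : seq {set gT}) : nat :=
  (\sum_(A <- s) #|A|)%N.

Definition mls_bound (n : nat) : nat :=
  (\sum_(p <- primes n) logn p n * p)%N.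

Definition is_MLS (gT : finGroupType) (G : {set gT}) (s : seq {set gT}) : Prop :=
  is_log_sig G s /\ ls_length s = mls_bound #|G|.

Definition has_MLS (gT : finGroupType) (G : {set gT}) : Prop :=
  exists s : seq {set gT}, is_MLS G s.

(* F is the field GF(q^2); the involutive field automorphism is x |-> x^q.
   SU_3(q) = { A in GL_3(F) | A * (A^(q))^T = 1, det A = 1 } (unitary w.r.t.
   the standard hermitian form, which is equivalent to any other
   nondegenerate hermitian form over a finite field). *)

Definition frobq (F : finFieldType) (q : nat) (x : F) : F := (x ^+ q)%R.

Definition SU3_set (F : finFieldType) (q : nat) : {set {'GL_3[F]}} :=
  [set u : {'GL_3[F]} |
     ((GLval u *m (map_mx (frobq q) (GLval u))^T == 1%:M)%R
      && (\det (GLval u) == 1)%R)].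

(* SU3_set is a subgroup; <<_>> equips it with its group structure
   (it equals SU3_set since the latter is closed under products). *)
Definition SU3 (F : finFieldType) (q : nat) : {group {'GL_3[F]}} :=
  <<SU3_set F q>>%G.

Definition PSU3 (F : finFieldType) (q : nat) :=
  (SU3 F q / 'Z(SU3 F q))%g.

(* Main.v *)
From HB Require Import structures.
Require Import Defs.
From mathcomp Require Import all_boot all_order all_algebra all_fingroup all_solvable all_field.
From mathcomp Require Import ring zify.

(* SU_3(q) acts on the row vectors of F^3, hence on isotropic and on nonisotropic
   points.  If A_1, .., A_n have prime sizes and every element of G is uniquely a
   product k a_1 .. a_n with k in a subgroup K, then a signature of K extends to
   one of G; solvable subgroups and transversals of normal subgroups with solvable
   quotient always factor in this way, and everything can be done modulo the
   (scalar) center.  A single block may be an arbitrary set of prime size, so it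
   can absorb whatever transversal is left over.

   (1) Let R be the stabilizer of a nonisotropic point, |G : R| = q^2 r with
   r = q^2 - q + 1.  R is the product of a solvable group fixing an isotropic
   point and a torus regular on the q + 1 isotropic points orthogonal to R's
   point.  Let Q be the unipotent radical of an isotropic point stabilizer and Z
   its subgroup of transvections.  An element of Q outside Z fixes no
   nonisotropic point, so G = R S L, where L is a transversal of Q / Z
   (of size q^2) and S is some set of size r, which is prime.

   (2) Let B be the (solvable) stabilizer of an isotropic point, |G : B| = q^3 + 1
   = (q + 1) r.  A cyclic torus C of order r acts semiregularly on the isotropic
   points, with q + 1 = 2 p orbits.  As G is 2-transitive on these points, the
   orbit representatives can be paired up into p translates of one pair, and
   G = B {1, s} A C with |A| = p. *)

Set Implicit Arguments. Unset Strict Implicit. Unset Printing Implicit Defensive.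
Import GRing.Theory.

(** * Factorizations into blocks of prime size *)

Local Open Scope group_scope.

Section LogSig.
Variable gT : finGroupType.
Implicit Types (A K H T : {set gT}) (s : seq {set gT}).

(** An exact factorization of [H] over [K]: by the cardinality equation each element of [H] is
    [k * a_1 * ... * a_n] in one way only. [K] and [H] are mere sets, so that factorizations chain
    through products such as [R * S]; hence the blocks are confined to [G] and not to [H]. *)
Definition prime_fact (G K H : {set gT}) :=
  exists s, [/\ all (fun A : {set gT} => (A \subset G) && prime #|A|) s,
    K * \prod_(A <- s) A = H & #|H| = (#|K| * \prod_(A <- s) #|A|)%N].

Lemma prodn_gt0_seq (I : eqType) (t : seq I) (a : I -> nat) :
  {in t, forall i, 0 < a i}%N -> (0 < \prod_(i <- t) a i)%N.
Proof.
elim: t => [|i t IH] a_gt0; first by rewrite big_nil.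
rewrite big_cons muln_gt0 a_gt0 ?mem_head //= IH // => j tj.
by rewrite a_gt0 // inE tj orbT.
Qed.

Lemma sum_prod_count s :
  (\sum_g prod_count s g = \prod_(A <- s) #|A|)%N.
Proof.
elim: s => [|A s IH] /=.
  by rewrite big_nil (bigD1 1) //= eqxx big1 // => i /negbTE->.
rewrite big_cons exchange_big /= -sum1_card big_distrl /=.
apply: eq_bigr => a _; rewrite mul1n -IH.
by rewrite [RHS](reindex_inj (mulgI a^-1)).
Qed.

Lemma prod_count_gt0 s g : g \in \prod_(A <- s) A -> (0 < prod_count s g)%N.
Proof.
elim: s g => [|A s IH] g /=; first by rewrite big_nil inE => ->.
rewrite big_cons => /mulsgP[a b Aa sb ->].
by rewrite (bigD1 a) //= addn_gt0 mulKg IH.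
Qed.

(** The counts sum over the whole group to the product of the block sizes, which is [#|G|], while
    each element of [G] is counted at least once; so each is counted exactly once. *)
Lemma prod_is_log_sig (G : {set gT}) s :
    all (fun A : {set gT} => A \subset G) s -> \prod_(A <- s) A = G ->
  #|G| = (\prod_(A <- s) #|A|)%N -> is_log_sig G s.
Proof.
move=> /allP sG prodG cardG; split=> // g.
have ge1 x : x \in G -> (1 <= prod_count s x ?= iff (prod_count s x == 1%N))%N.
  move=> Gx; rewrite /leqif eq_sym; split=> //; apply: prod_count_gt0.
  by rewrite prodG.
have tot : (\sum_(x in G) prod_count s x <= \sum_(x in G) 1)%N.
  rewrite sum1_card cardG -sum_prod_count [leqRHS](bigID [in G]) /=.
  exact: leq_addr.
have [le] := leqif_sum ge1.
rewrite eqn_leq le tot => /esym/forall_inP all1.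
by move=> Gg; apply/eqP/all1.
Qed.

Lemma prod_primes_gt0 (t : seq nat) : all prime t -> (0 < \prod_(n <- t) n)%N.
Proof. by move/allP=> pr_t; apply: prodn_gt0_seq => n /pr_t/prime_gt0. Qed.

Lemma logn_prod_primes (t : seq nat) p :
  all prime t -> logn p (\prod_(n <- t) n) = (\sum_(n <- t) (n == p))%N.
Proof.
elim: t => [|n t IH] /=; first by rewrite !big_nil logn1.
case/andP=> pr_n pr_t; rewrite !big_cons lognM ?prod_primes_gt0 ?(prime_gt0 pr_n) ?IH //.
by rewrite logn_prime // eq_sym.
Qed.

(** The list [t] is the prime factorization of its product, so each prime occurs in the sum as often
    as in the bound. *)
Lemma mls_bound_prod_primes (t : seq nat) :
  all prime t -> mls_bound (\prod_(n <- t) n) = (\sum_(n <- t) n)%N.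
Proof.
move=> pr_t; rewrite /mls_bound.
under eq_bigr => p _ do rewrite logn_prod_primes // big_distrl /=.
rewrite exchange_big /=; apply: eq_big_seq => n tn.
have pr_n := allP pr_t _ tn.
have nP : n \in primes (\prod_(m <- t) m).
  by rewrite mem_primes pr_n prod_primes_gt0 //= (big_rem n) //= dvdn_mulr.
rewrite (bigD1_seq n) ?primes_uniq //= eqxx mul1n big1 ?addn0 // => m.
by rewrite eq_sym => /negbTE->.
Qed.

Lemma prime_fact_has_MLS (G : {set gT}) s :
    all (fun A : {set gT} => (A \subset G) && prime #|A|) s ->
    \prod_(A <- s) A = G -> #|G| = (\prod_(A <- s) #|A|)%N -> has_MLS G.
Proof.
rewrite all_predI => /andP[sG pr_s] prodG cardG; exists s; split.
  exact: prod_is_log_sig.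
rewrite /ls_length cardG -(big_map (fun A : {set gT} => #|A|) xpredT id).
rewrite -(big_map (fun A : {set gT} => #|A|) xpredT id).
by rewrite mls_bound_prod_primes // all_map.
Qed.

Lemma mulg_imset A K : A * K = [set u.1 * u.2 | u in setX A K].
Proof.
apply/setP=> x; apply/mulsgP/imsetP => [[a k Aa Kk ->]|[[a k] /setXP[]]].
  by exists (a, k); rewrite // inE Aa.
by exists a k.
Qed.

Lemma card_mulg_le A K : (#|(A * K)%g| <= #|A| * #|K|)%N.
Proof. by rewrite -cardsX mulg_imset leq_imset_card. Qed.

Lemma card_prodg_le K s :
  (#|(K * \prod_(A <- s) A)%g| <= #|K| * \prod_(A <- s) #|A|)%N.
Proof.
elim: s K => [|A s IH] K; first by rewrite !big_nil mulg1 muln1.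
rewrite !big_cons mulgA mulnA; apply: (leq_trans (IH (K * A))).
by rewrite leq_mul2r card_mulg_le orbT.
Qed.

Lemma prime_fact_refl (G K : {set gT}) : prime_fact G K K.
Proof. by exists [::]; rewrite !big_nil mulg1 muln1. Qed.

Lemma prime_fact_trans (G K H T : {set gT}) :
  prime_fact G K H -> prime_fact G H T -> prime_fact G K T.
Proof.
move=> [s [s1 s2 s3]] [t [t1 t2 t3]]; exists (s ++ t).
by rewrite all_cat s1 t1 !big_cat /= mulgA s2 t2 t3 s3 mulnA.
Qed.

Lemma prime_fact1 (G K A : {set gT}) :
    A \subset G -> prime #|A| -> #|(K * A)%g| = (#|K| * #|A|)%N ->
  prime_fact G K (K * A).
Proof.
by move=> AG pA cA; exists [:: A]; rewrite !big_cons !big_nil mulg1 muln1 /= AG pA.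
Qed.

(** Since [T] absorbs [Z] on the right, the blocks leading from [Z] to [Q] also lead from [T] to
    [T * Q]; the cardinality hypothesis keeps this exact. *)
Lemma prime_fact_mul (G T Z Q : {set gT}) :
    T * Z = T -> (#|(T * Q)%g| * #|Z| = #|T| * #|Q|)%N -> (0 < #|Z|)%N ->
  prime_fact G Z Q -> prime_fact G T (T * Q).
Proof.
move=> TZ cTQ Z0 [s [s1 s2 s3]]; exists s; rewrite -s2 mulgA TZ; split=> //.
move: cTQ; rewrite s3 -{1}s2 mulgA TZ mulnCA mulnC => /eqP.
by rewrite eqn_pmul2l // => /eqP.
Qed.

(** Induction on [#|H|]: a nontrivial solvable [H / K] has a normal subgroup of prime index, and
    right coset representatives of its preimage [M'] in [H] form the last block. *)
Lemma prime_fact_solvable (G K H : {group gT}) :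
  H \subset G -> solvable H -> K <| H -> prime_fact G K H.
Proof.
have [n] := ubnP #|H|; elim: n H => // n IH H leHn sHG solH nKH.
have [->|neKH] := eqVneq (K : {set gT}) H; first exact: prime_fact_refl.
have solHK : solvable (H / K) by apply: quotient_sol.
have ntHK : H / K != 1.
  apply: contra neKH => /eqP/trivgP; rewrite quotient_sub1 ?normal_norm // => sHK.
  by rewrite eqEsubset sHK normal_sub.
have [M nMHK prM] := sol_prime_factor_exists solHK ntHK.
have [M' defM sKM' nM'H] := inv_quotientN nKH nMHK.
have prM' : prime #|H : M'|.
  move: prM; rewrite -(index_quotient_eq _ (normal_sub nM'H) (normal_norm nKH)).
    by rewrite defM.
  by rewrite (subset_trans _ sKM') // subsetIr.
have sM'H := normal_sub nM'H.
apply: prime_fact_trans (IH M' _ (subset_trans sM'H sHG) _ _) _.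
- rewrite ltnS in leHn; apply: leq_trans leHn; rewrite -(Lagrange sM'H).
  by rewrite -[ltnLHS]muln1 ltn_pmul2l ?cardG_gt0 // prime_gt1.
- exact: solvableS solH.
- exact: normalS nKH.
set A := [set repr C | C in rcosets M' H].
have cA : #|A| = #|H : M'|.
  rewrite card_in_imset // => _ _ /rcosetsP[x _ ->] /rcosetsP[y _ ->] e.
  by rewrite -(rcoset_repr M' x) e rcoset_repr.
have AH : A \subset H.
  apply/subsetP=> _ /imsetP[_ /rcosetsP[x Hx ->] ->].
  have : repr (M' :* x) \in M' :* x by apply: mem_repr; apply: rcoset_refl.
  by case/rcosetP=> m /(subsetP sM'H) Hm ->; rewrite groupM.
have M'A : M' * A = H.
  apply/eqP; rewrite eqEsubset mul_subG //=; apply/subsetP=> x Hx.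
  have: x \in M' :* repr (M' :* x) by rewrite rcoset_repr rcoset_refl.
  case/rcosetP=> m M'm ->; rewrite mem_mulg //.
  by apply: imset_f; apply/rcosetsP; exists x.
rewrite -[in X in prime_fact _ _ X]M'A; apply: prime_fact1.
- exact: subset_trans sHG.
- by rewrite cA.
by rewrite M'A cA Lagrange.
Qed.

Lemma leq_prod_eq (I : eqType) (t : seq I) (a b : I -> nat) :
    (forall i, i \in t -> a i <= b i /\ 0 < b i)%N ->
    (\prod_(i <- t) b i <= \prod_(i <- t) a i)%N ->
  forall i, i \in t -> a i = b i.
Proof.
elim: t => // i t IH ab; rewrite !big_cons => le.
have [ai bi] := ab i (mem_head _ _).
have ab' j : j \in t -> (a j <= b j /\ 0 < b j)%N.
  by move=> tj; apply: ab; rewrite inE tj orbT.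
have bt : (0 < \prod_(i <- t) b i)%N.
  by apply: prodn_gt0_seq => j /ab'[].
have lt : (\prod_(i <- t) a i <= \prod_(i <- t) b i)%N.
  by rewrite big_seq [leqRHS]big_seq; apply: leq_prod => j /ab'[].
have eai : a i = b i.
  apply/eqP; rewrite eqn_leq ai /= leqNgt; apply/negP=> lt_ai.
  have : (a i * \prod_(i <- t) a i < b i * \prod_(i <- t) b i)%N.
    apply: leq_ltn_trans (_ : (a i * \prod_(i <- t) b i < _)%N).
      by rewrite leq_mul2l lt orbT.
    by rewrite ltn_pmul2r.
  by rewrite ltnNge le.
move=> j; rewrite inE => /predU1P[->//|]; apply: IH => //.
by move: le; rewrite eai leq_pmul2l.
Qed.

End LogSig.

(** The images of the blocks multiply to [G / N], whose order is the product of the original block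
    sizes. An image is never larger than its block, so no block shrinks and all sizes stay prime. *)
Lemma quotient_has_MLS (gT : finGroupType) (G N : {group gT}) :
  N <| G -> prime_fact G N G -> has_MLS (G / N).
Proof.
move=> nNG [s [s1 s2 s3]].
have sNG := normal_norm nNG.
have cGN : #|G / N| = (\prod_(A <- s) #|A|)%N.
  by rewrite card_quotient // -divgS ?normal_sub // s3 mulKn ?cardG_gt0.
have prodGN : \prod_(A <- [seq (A / N)%g | A : {set gT} <- s]) A = G / N.
  rewrite -s2 quotientMl ?normG // trivg_quotient mul1g big_map /=.
  elim: (s) (s1) => [|A t IH] /=; first by rewrite !big_nil quotient1.
  case/andP=> /andP[AG _] tG; rewrite !big_cons quotientMl ?IH //.
  exact: subset_trans sNG.
have eqc : forall A, A \in s -> #|A / N| = #|A|.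
  apply: leq_prod_eq => [A sA|].
    have /andP[_ pA] := allP s1 _ sA.
    by rewrite prime_gt0 //; split=> //; apply: leq_morphim.
  rewrite -cGN -prodGN -(mul1g (\prod_(A <- _) A)).
  by apply: leq_trans (card_prodg_le _ _) _; rewrite cards1 mul1n big_map.
apply: (@prime_fact_has_MLS _ _ [seq (A / N)%g | A : {set gT} <- s]) => //.
  apply/allP=> _ /mapP[A sA ->] /=.
  by have /andP[AG pA] := allP s1 _ sA; rewrite eqc // pA quotientS.
by rewrite cGN big_map; apply: eq_big_seq => A /eqc->.
Qed.

(** * Blocks that are not subgroups: double cosets and paired cosets *)

Section Transversal.
Variables (gT : finGroupType).

Lemma rcoset_union_transversal (R : {group gT}) (T : {set gT}) :
  R * T = T -> exists S : {set gT}, [/\ S \subset T, R * S = T & #|T| = (#|R| * #|S|)%N].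
Proof.
move=> RT; set S := [set repr (R :* x) | x in T].
have inT x r : x \in T -> r \in R -> r * x \in T.
  by move=> Tx Rr; rewrite -RT mem_mulg.
have reprR x : exists2 r, r \in R & repr (R :* x) = r * x.
  by apply/rcosetP/mem_repr/rcoset_refl.
have ST : S \subset T.
  by apply/subsetP=> _ /imsetP[x Tx ->]; have [r Rr ->] := reprR x; apply: inT.
have RS : R * S = T.
  apply/eqP; rewrite eqEsubset -{1}RT mulgS //=; apply/subsetP=> x Tx.
  have: x \in R :* repr (R :* x) by rewrite rcoset_repr rcoset_refl.
  by case/rcosetP=> m Rm e; rewrite e mem_mulg //; apply: imset_f.
exists S; split=> //; rewrite -RS -cardsX mulg_imset card_in_imset //.
move=> [r a] [r' a'] /setXP[/= Rr Sa] /setXP[/= Rr' Sa'] e.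
have ea : a = a'.
  have: R :* a = R :* a' by rewrite -[in LHS](rcoset_id Rr) -[in RHS](rcoset_id Rr') -!rcosetM e.
  case/imsetP: Sa => x _ ->; case/imsetP: Sa' => y _ ->.
  by rewrite !rcoset_repr => ->.
by move: e; rewrite ea => /mulIg->.
Qed.

(* If no conjugate of R meets Q outside Z, each double coset R y Q is a disjoint
   union of [Q : Z] translates of R y Z; T is the union of the sets R y Z. *)
Lemma double_coset_transversal (G R Q Z : {group gT}) :
    R \subset G -> Q \subset G -> Z \subset Q ->
    (forall g, g \in G -> R :^ g :&: Q \subset Z) ->
  exists S : {set gT}, [/\ S \subset G, #|(R * S)%g| = (#|R| * #|S|)%N,
    R * S * Z = R * S, R * S * Q = G & (#|(R * S)%g| * #|Q| = #|G| * #|Z|)%N].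
Proof.
move=> sRG sQG sZQ RQ.
(* [T] is taken maximal among the unions of sets [R y Z] in which two elements of the same coset
   [t Q] differ by an element of [Z] only. *)
pose P (T : {set gT}) := [&& T \subset G, R * T * Z == T &
  [forall t in T, forall q in Q, (t * q \in T) ==> (q \in Z)]].
have [|T /maxsetP[/and3P[TG /eqP RTZ /forall_inP TQ] Tmax] _] := @maxset_exists _ P set0.
  rewrite /P sub0set mulg0 mul0g eqxx; by apply/forall_inP=> t; rewrite inE.
have inT r t z : r \in R -> t \in T -> z \in Z -> r * t * z \in T.
  by move=> Rr Tt Zz; rewrite -RTZ !mem_mulg.
have RT : R * T = T.
  apply/eqP; rewrite eqEsubset mulG_subr andbT; apply/subsetP=> _ /mulsgP[r t Rr Tt ->].
  by rewrite -[r * t]mulg1 inT.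
have TZ : T * Z = T.
  apply/eqP; rewrite eqEsubset mulG_subl andbT; apply/subsetP=> _ /mulsgP[t z Tt Zz ->].
  by rewrite -[t]mul1g inT.
have TQG : T * Q = G.
  apply/eqP; rewrite eqEsubset mul_subG //=; apply/subsetP=> g Gg.
  apply/negPn/negP=> gTQ.
  have nTQ r z q : r \in R -> z \in Z -> q \in Q -> r * g * z * q \notin T.
    move=> Rr Zz Qq; apply: contra gTQ => Tx.
    have -> : g = (r^-1 * (r * g * z * q)) * (z * q)^-1.
      by rewrite -!mulgA mulKg invMg (mulKVg q) mulgV mulg1.
    by rewrite mem_mulg ?groupV ?groupM ?(subsetP sZQ z) // -RT mem_mulg ?groupV.
  (* If [T * Q] missed [g], then [R g Z] could be added to [T], against maximality. *)
  have PU : P (T :|: R * [set g] * Z).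
    apply/and3P; split.
    - by rewrite subUset TG !mul_subG ?sub1set // (subset_trans sZQ).
    - apply/eqP; rewrite mulgU mulUg; congr (_ :|: _) => //.
      by rewrite -!mulgA mulGid !mulgA mulGid.
    apply/forall_inP=> t /setUP[Tt|/mulsgP[_ z /mulsgP[r _ Rr /set1P-> ->] Zz ->]];
      apply/forall_inP=> q Qq; apply/implyP.
    - case/setUP=> [Ttq|].
        by have /forall_inP/(_ q Qq)/implyP := TQ t Tt; apply.
      case/mulsgP=> _ z /mulsgP[r _ Rr /set1P-> ->] Zz e.
      have := nTQ r z q^-1 Rr Zz; rewrite groupV => /(_ Qq).
      by rewrite -e mulgK Tt.
    - case/setUP=> [Ttq|]; first by have := nTQ r z q Rr Zz Qq; rewrite Ttq.
      case/mulsgP=> _ z' /mulsgP[r' _ Rr' /set1P-> ->] Zz' e.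
      (* Two elements of [R g Z] in the same coset of [Q] differ, up to [Z], by a conjugate of an
         element of [R]; it lies in [Q], hence in [Z]. *)
      have e1 : z * q * z'^-1 = (r^-1 * r') ^ g.
        rewrite conjgE; apply: (mulgI (r * g)).
        by rewrite !mulgA e !mulgK mulgV mul1g.
      have : z * q * z'^-1 \in Z.
        apply: (subsetP (RQ g Gg)); rewrite inE {1}e1 memJ_conjg groupM ?groupV //=.
        by rewrite !groupM ?groupV // (subsetP sZQ).
      by rewrite groupMr ?groupV // groupMl.
  have := Tmax _ PU (subsetUl _ _) => /setUidPl/subsetP/(_ g).
  have -> : g \in R * [set g] * Z by rewrite -[g in g \in _]mulg1 -[g in g * 1]mul1g !mem_mulg ?set11.
  move/(_ isT) => Tg; case/negP: gTQ; by rewrite -[g]mulg1 mem_mulg.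
(* An element [t0 * q0] of [G] has exactly [#|Z|] expressions in [T * Q], with factors [t0 * z^-1]
   and [z * q0] for [z] in [Z]. *)
have cT : (#|T| * #|Q| = #|G| * #|Z|)%N.
  rewrite -cardsX -sum1_card (partition_big (fun u => u.1 * u.2) [in G]) /=; last first.
    by move=> [t q] /setXP[/= Tt Qq]; rewrite -TQG mem_mulg.
  rewrite -sum_nat_const; apply: eq_bigr => g; rewrite -TQG => /mulsgP[t0 q0 Tt0 Qq0 ->].
  rewrite sum1_card -(card_imset _ (_ : injective (fun z => (t0 * z^-1, z * q0)))); last first.
    by move=> z z' [_ /mulIg].
  apply: eq_card => -[t q]; apply/andP/imsetP.
    case=> /setXP[/= Tt Qq] /eqP e; exists (q * q0^-1).
      have /forall_inP/(_ (q * q0^-1)) := TQ t Tt; rewrite groupM ?groupV // => /(_ isT).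
      by move/implyP; apply; rewrite mulgA e mulgK.
    by rewrite mulgVK invMg invgK mulgA -e mulgK.
  case=> z Zz [-> ->]; split; last by rewrite /= mulgA mulgVK.
  have Tz : t0 * z^-1 \in T by rewrite -TZ mem_mulg ?groupV.
  by apply/setXP; split=> //=; rewrite groupM // (subsetP sZQ).
have [S [ST RS cS]] := rcoset_union_transversal RT.
by exists S; rewrite RS; split=> //; rewrite (subset_trans ST).
Qed.

(** [S] is cut into arbitrary pairs, each of which is a translate of [D] modulo [B]. The bound on
    [#|A|] is an inequality because translating elements may coincide; in the application a count
    forces equality. *)
Lemma pair_cosets (G : {set gT}) (B D S : {set gT}) n :
    (forall y y', y \in S -> y' \in S -> y != y' ->
       exists2 a, a \in G & B * D * [set a] = B * [set y; y']) ->
    #|S| = n.*2 ->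
  exists A : {set gT}, [/\ A \subset G, (#|A| <= n)%N & B * D * A = B * S].
Proof.
elim: n S => [|n IH] S pairS cS.
  exists set0; rewrite sub0set cards0 !mulg0; split=> //.
  by move/eqP: cS; rewrite cards_eq0 => /eqP->; rewrite mulg0.
have /card_gt0P[y Sy] : (0 < #|S|)%N by rewrite cS.
move: cS; rewrite (cardsD1 y) Sy doubleS add1n => -[cS].
have /card_gt0P[y' /setD1P[ne Sy']] : (0 < #|S :\ y|)%N by rewrite cS.
move: cS; rewrite (cardsD1 y') in_setD1 ne Sy' add1n => -[cS].
have ne' : y != y' by rewrite eq_sym.
have [a Ga ea] := pairS _ _ Sy Sy' ne'.
have [||A [AG cA eA]] := IH (S :\ y :\ y') => //.
  by move=> x x' /setD1P[_ /setD1P[_ Sx]] /setD1P[_ /setD1P[_ Sx']]; apply: pairS.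
exists (a |: A); rewrite subUset sub1set Ga AG; split=> //.
  by rewrite (leq_trans (leq_card_setU _ _)) // cards1.
rewrite mulgU ea eA -mulgU; congr (B * _).
apply/setP=> x; rewrite !inE.
by case: eqVneq => [->|_]; case: eqVneq => [->|_]; rewrite ?Sy ?Sy' ?orbT.
Qed.

End Transversal.

Lemma expg_coprime_eq1 (gT : finGroupType) (H : {group gT}) x n :
  coprime n #|H| -> x \in H -> x ^+ n = 1 -> x = 1.
Proof.
move=> /eqP cop Hx xn; apply/eqP; rewrite -order_eq1 -dvdn1 -cop dvdn_gcd.
by rewrite order_dvdn xn eqxx order_dvdG.
Qed.

Lemma conjg_prime_order (gT : finGroupType) (H : {group gT}) u g n :
    u \in H -> g \in H -> u != 1 -> u ^+ n = 1 ->
  exists w, [/\ w \in H, w != 1, w ^+ n = 1 & w * g = g * u].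
Proof.
move=> Hu Hg u1 un; exists (u ^ g^-1).
by rewrite groupJ ?groupV // conjg_eq1 -conjXg un conj1g conjgE invgK !mulgA mulgVK.
Qed.

Section PrimeOrder.
Variables (gT : finGroupType) (G : {group gT}) (p : nat).
Hypothesis p_pr : prime p.

Lemma Cauchy_expg : p %| #|G| -> exists x, [/\ x \in G, x != 1 & x ^+ p = 1].
Proof.
move=> pG; have [x Gx ox] := Cauchy p_pr pG.
by exists x; rewrite -order_eq1 ox -ox expg_order; split=> //; rewrite ox neq_ltn prime_gt1 ?orbT.
Qed.

Lemma prime_dvd_cardG x : x \in G -> x != 1 -> x ^+ p = 1 -> p %| #|G|.
Proof.
by move=> Gx x1 xp; rewrite -(nt_prime_order p_pr xp x1) order_dvdG.
Qed.

End PrimeOrder.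

Local Close Scope group_scope.

(** * Hermitian geometry of F^3 *)

Local Open Scope ring_scope.

Definition i0 : 'I_3 := @Ordinal 3 0 isT.
Definition i1 : 'I_3 := @Ordinal 3 1 isT.
Definition i2 : 'I_3 := @Ordinal 3 2 isT.

Lemma ord3_ind (P : 'I_3 -> Prop) : P i0 -> P i1 -> P i2 -> forall i, P i.
Proof.
move=> P0 P1 P2 [[|[|[|//]]] lt_i3].
- by have -> : Ordinal lt_i3 = i0 by apply: val_inj.
- by have -> : Ordinal lt_i3 = i1 by apply: val_inj.
- by have -> : Ordinal lt_i3 = i2 by apply: val_inj.
Qed.

Lemma sum3E (V : nmodType) (f : 'I_3 -> V) : \sum_i f i = f i0 + f i1 + f i2.
Proof.
rewrite !big_ord_recl big_ord0 addr0 addrA.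
by congr (f _ + f _ + f _); apply: val_inj.
Qed.

Section Vectors.
Variable F : fieldType.

Definition vec3 (a b c : F) : 'rV[F]_3 := \row_i nth 0 [:: a; b; c] i.

Lemma vec3E a b c : ((vec3 a b c 0 i0 = a) * (vec3 a b c 0 i1 = b) * (vec3 a b c 0 i2 = c))%type.
Proof. by rewrite !mxE. Qed.

Lemma vec3P (u v : 'rV[F]_3) :
  u 0 i0 = v 0 i0 -> u 0 i1 = v 0 i1 -> u 0 i2 = v 0 i2 -> u = v.
Proof. by move=> e0 e1 e2; apply/rowP; elim/ord3_ind. Qed.

Definition mx3 (u v w : 'rV[F]_3) : 'M[F]_3 :=
  \matrix_(i, j) (nth 0 [:: u; v; w] i) 0 j.

Lemma row_mx3 u v w :
  ((row i0 (mx3 u v w) = u) * (row i1 (mx3 u v w) = v) * (row i2 (mx3 u v w) = w))%type.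
Proof. by do ![split]; apply/rowP=> j; rewrite !mxE. Qed.

Lemma row3P (A B : 'M[F]_3) :
  row i0 A = row i0 B -> row i1 A = row i1 B -> row i2 A = row i2 B -> A = B.
Proof. by move=> e0 e1 e2; apply/row_matrixP; elim/ord3_ind. Qed.

Lemma mx3_mulmx u v w (A : 'M[F]_3) :
  mx3 u v w *m A = mx3 (u *m A) (v *m A) (w *m A).
Proof. by apply: row3P; rewrite row_mul !row_mx3. Qed.

Lemma det3E (A : 'M[F]_3) : \det A =
  A i0 i0 * (A i1 i1 * A i2 i2 - A i1 i2 * A i2 i1)
  - A i0 i1 * (A i1 i0 * A i2 i2 - A i1 i2 * A i2 i0)
  + A i0 i2 * (A i1 i0 * A i2 i1 - A i1 i1 * A i2 i0).
Proof.
pose f (m n : nat) := A (inord m) (inord n).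
have AE i j : A i j = f i j by rewrite /f !inord_val.
rewrite (expand_det_row _ i0) sum3E /cofactor.
do 3!rewrite (expand_det_row _ ord0) !big_ord_recl big_ord0 /cofactor !det_mx11 !mxE.
rewrite !AE /= /bump /= !(addn0, add0n, addn1) /=.
by rewrite !exprS !expr0; ring.
Qed.

End Vectors.

(** * The hermitian form, its cross product and special unitary matrices *)

Section Hermitian.
Variables (F : finFieldType) (conj : {rmorphism F -> F}).
Hypothesis conjK : involutive conj.

Definition herm (x y : 'rV[F]_3) : F :=
  x 0 i0 * conj (y 0 i0) + x 0 i1 * conj (y 0 i1) + x 0 i2 * conj (y 0 i2).

(** The conjugated cross product: conjugation makes it orthogonal to [x] and [y] for the
    sesquilinear form, and [herm u (perp x y)] is the determinant with rows [u], [x], [y]. *)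
Definition perp (x y : 'rV[F]_3) : 'rV[F]_3 := vec3
  (conj (x 0 i1 * y 0 i2 - x 0 i2 * y 0 i1))
  (conj (x 0 i2 * y 0 i0 - x 0 i0 * y 0 i2))
  (conj (x 0 i0 * y 0 i1 - x 0 i1 * y 0 i0)).

Let conjE := (rmorphD, rmorphB, rmorphM, rmorphN, conjK).

Lemma herm_conj x y : herm x y = conj (herm y x).
Proof. by rewrite /herm !conjE; ring. Qed.

Lemma hermDl x x' y : herm (x + x') y = herm x y + herm x' y.
Proof. by rewrite /herm !mxE; ring. Qed.

Lemma hermZl a x y : herm (a *: x) y = a * herm x y.
Proof. by rewrite /herm !mxE; ring. Qed.

Lemma hermDr x y y' : herm x (y + y') = herm x y + herm x y'.
Proof. by rewrite /herm !mxE !conjE; ring. Qed.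

Lemma hermZr a x y : herm x (a *: y) = conj a * herm x y.
Proof. by rewrite /herm !mxE !conjE; ring. Qed.

Lemma hermNl x y : herm (- x) y = - herm x y.
Proof. by rewrite -scaleN1r hermZl mulN1r. Qed.

Lemma hermNr x y : herm x (- y) = - herm x y.
Proof. by rewrite -scaleN1r hermZr rmorphN1 mulN1r. Qed.

Lemma herm0l y : herm 0 y = 0. Proof. by rewrite -(scale0r y) hermZl mul0r. Qed.

Definition hermE := (hermDl, hermDr, hermZl, hermZr, hermNl, hermNr).

Lemma herm_mx x y : (x *m (map_mx conj y)^T) 0 0 = herm x y.
Proof. by rewrite mxE sum3E !mxE. Qed.

Lemma herm_nondeg v : (forall u, herm u v = 0) -> v = 0.
Proof.
move=> hv0; apply: vec3P; rewrite [RHS]mxE; apply: (can_inj conjK); rewrite rmorph0.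
- by have := hv0 (vec3 1 0 0); rewrite /herm !vec3E mul1r !mul0r !addr0.
- by have := hv0 (vec3 0 1 0); rewrite /herm !vec3E mul1r !mul0r !addr0 add0r.
- by have := hv0 (vec3 0 0 1); rewrite /herm !vec3E mul1r !mul0r !add0r.
Qed.

Lemma herm_perpl x y : herm x (perp x y) = 0.
Proof. by rewrite /herm !vec3E !conjE; ring. Qed.

Lemma herm_perpr x y : herm y (perp x y) = 0.
Proof. by rewrite /herm !vec3E !conjE; ring. Qed.

Lemma herm_perp x y :
  herm (perp x y) (perp x y) = herm x x * herm y y - herm x y * herm y x.
Proof. by rewrite /herm !vec3E !conjE; ring. Qed.

Lemma perp_perp x y : perp x (perp x y) = herm y x *: x - herm x x *: y.
Proof.
by apply: vec3P; rewrite !vec3E !mxE /herm !conjE; ring.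
Qed.

Lemma perpDr x y y' : perp x (y + y') = perp x y + perp x y'.
Proof. by apply: vec3P; rewrite ![RHS]mxE ![LHS]mxE /= !mxE -rmorphD; congr (conj _); ring. Qed.

Lemma perpZr a x y : perp x (a *: y) = conj a *: perp x y.
Proof. by apply: vec3P; rewrite ![RHS]mxE ![LHS]mxE /= !mxE -rmorphM; congr (conj _); ring. Qed.

Lemma perpxx x : perp x x = 0.
Proof. by apply: vec3P; rewrite ![RHS]mxE ![LHS]mxE /= -[RHS](rmorph0 conj); congr (conj _); ring. Qed.

Lemma perpC x y : perp y x = - perp x y.
Proof. by apply: vec3P; rewrite ![RHS]mxE ![LHS]mxE /= !mxE -rmorphN; congr (conj _); ring. Qed.

Lemma det_mx3 u x y : \det (mx3 u x y) = herm u (perp x y).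
Proof. by rewrite det3E !mxE /= /herm !vec3E !conjK; ring. Qed.

Lemma det_mx3_cycle (u x y : 'rV[F]_3) : \det (mx3 u x y) = \det (mx3 x y u).
Proof. by rewrite !det3E !mxE /=; ring. Qed.

Definition ctrmx (A : 'M[F]_3) := (map_mx conj A)^T.

Lemma ctrmxM A B : ctrmx (A *m B) = ctrmx B *m ctrmx A.
Proof. by rewrite /ctrmx map_mxM trmx_mul. Qed.

Lemma ctrmxK : involutive ctrmx.
Proof. by move=> A; apply/matrixP=> i j; rewrite !mxE conjK. Qed.

Lemma ctrmx1 : ctrmx 1%:M = 1%:M.
Proof. by rewrite /ctrmx map_mx1 trmx1. Qed.

Lemma herm_mulmx x y A : herm (x *m A) y = herm x (y *m ctrmx A).
Proof.
rewrite -!herm_mx map_mxM trmx_mul -mulmxA; congr ((_ *m (_ *m _)) _ _).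
by apply/matrixP=> i j; rewrite !mxE conjK.
Qed.

Lemma mulmx_ctr (A B : 'M[F]_3) i j : (A *m ctrmx B) i j = herm (row i A) (row j B).
Proof. by rewrite mxE sum3E /herm !mxE. Qed.

Lemma det_ctrmx A : \det (ctrmx A) = conj (\det A).
Proof. by rewrite /ctrmx det_tr det_map_mx. Qed.

Definition SU (A : 'M[F]_3) := (A *m ctrmx A == 1%:M) && (\det A == 1).

Lemma SU_herm A x y : SU A -> herm (x *m A) (y *m A) = herm x y.
Proof. by case/andP=> /eqP AA _; rewrite herm_mulmx -mulmxA AA mulmx1. Qed.

(** Pairing both sides with an arbitrary [u] gives determinants, which agree because [\det A = 1];
    nondegeneracy concludes. *)
Lemma SU_perp A x y : SU A -> perp (x *m A) (y *m A) = perp x y *m A.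
Proof.
move=> suA; have /andP[/eqP AA /eqP dA] := suA.
apply/eqP; rewrite -subr_eq0; apply/eqP/herm_nondeg => u.
have -> : u = (u *m ctrmx A) *m A by rewrite -mulmxA (mulmx1C AA) mulmx1.
rewrite hermE hermNr SU_herm // -!det_mx3 -mx3_mulmx det_mulmx dA mulr1.
exact: subrr.
Qed.

(** A form of Witt's theorem for bases: [M^-1 N] preserves the form because the Gram matrices
    agree. *)
Lemma gram_SU (M N : 'M[F]_3) :
    M *m ctrmx M = N *m ctrmx N -> \det M = \det N -> \det M != 0 ->
  exists2 A, SU A & M *m A = N.
Proof.
move=> gr dMN dM; have uM : M \in unitmx by rewrite unitmxE unitfE.
exists (invmx M *m N); last by rewrite mulKVmx.
apply/andP; split.
  rewrite ctrmxM mulmxA -(mulmxA (invmx M)) -gr !mulmxA mulVmx // mul1mx.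
  by rewrite -ctrmxM mulVmx // ctrmx1.
by rewrite det_mulmx det_inv dMN mulVf // -dMN.
Qed.

Definition hyperbolic x y := [/\ herm x x = 0, herm y y = 0 & herm x y = 1].

Section HyperbolicPair.
Variables x y : 'rV[F]_3.
Hypothesis hyp_xy : hyperbolic x y.
Let z := perp x y.

Lemma hyp_herm : ((herm x x = 0) * (herm x y = 1) * (herm x z = 0) *
  (herm y x = 1) * (herm y y = 0) * (herm y z = 0) *
  (herm z x = 0) * (herm z y = 0) * (herm z z = -1))%type.
Proof.
case: hyp_xy => xx yy xy; have yx : herm y x = 1 by rewrite herm_conj xy rmorph1.
have xz := herm_perpl x y; have yz := herm_perpr x y; rewrite -/z in xz yz.
have zx : herm z x = 0 by rewrite herm_conj xz rmorph0.
have zy : herm z y = 0 by rewrite herm_conj yz rmorph0.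
have zz : herm z z = -1 by rewrite herm_perp xx yy xy yx; ring.
by do ![split].
Qed.

Lemma hyp_det : \det (mx3 x z y) = 1.
Proof. by rewrite det_mx3_cycle det_mx3 perpC hermNr hyp_herm opprK. Qed.

Lemma hyp_ext u v :
  herm u x = herm v x -> herm u y = herm v y -> herm u z = herm v z -> u = v.
Proof.
move=> ux uy uz; apply/eqP; rewrite -subr_eq0; apply/eqP.
have uM : ctrmx (mx3 x z y) \in unitmx by rewrite unitmxE det_ctrmx hyp_det rmorph1 unitr1.
apply: (can_inj (mulmxK uM)); rewrite mul0mx.
have e w : w *m ctrmx (mx3 x z y) = vec3 (herm w x) (herm w z) (herm w y).
  by apply: vec3P; rewrite [LHS]mxE sum3E vec3E /herm !mxE.
by rewrite e !hermE ux uy uz !subrr; apply: vec3P; rewrite vec3E mxE.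
Qed.

(** [x] and [y] are dual to each other, which crosses their coefficients, and [herm z z = -1] gives
    the minus sign. *)
Lemma hyp_decomp v : v = herm v y *: x - herm v z *: z + herm v x *: y.
Proof. by apply: hyp_ext; rewrite !hermE !hyp_herm; ring. Qed.

Lemma hyp_mx_ext (A B : 'M[F]_3) :
  x *m A = x *m B -> z *m A = z *m B -> y *m A = y *m B -> A = B.
Proof.
move=> ex ez ey; have uM : mx3 x z y \in unitmx by rewrite unitmxE hyp_det unitr1.
by apply: (can_inj (mulKmx uM)); rewrite !mx3_mulmx ex ez ey.
Qed.

End HyperbolicPair.

(** The bases [x, perp x y, y] of all hyperbolic pairs have the same Gram matrix and determinant
    1. *)
Lemma hyp_transitive x y x' y' : hyperbolic x y -> hyperbolic x' y' ->
  exists A, [/\ SU A, x *m A = x' & y *m A = y'].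
Proof.
move=> h1 h2; have [||| A suA] := @gram_SU (mx3 x (perp x y) y) (mx3 x' (perp x' y') y').
- apply/matrixP=> i j; rewrite !mulmx_ctr; move: i j.
  by elim/ord3_ind; elim/ord3_ind; rewrite !row_mx3 (hyp_herm h1) (hyp_herm h2).
- by rewrite !hyp_det.
- by rewrite hyp_det // oner_eq0.
rewrite mx3_mulmx => e; exists A; split=> //.
  by move/(congr1 (row i0)): e; rewrite !row_mx3.
by move/(congr1 (row i2)): e; rewrite !row_mx3.
Qed.

(** The row [x] comes last so that the matrix sends the third basis vector to [x]. *)
Lemma orthonormal_SU x y :
  herm x x = 1 -> herm y y = 1 -> herm x y = 0 -> SU (mx3 y (perp x y) x).
Proof.
move=> xx yy xy; have yx : herm y x = 0 by rewrite herm_conj xy rmorph0.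
have xz := herm_perpl x y; have yz := herm_perpr x y.
have zz : herm (perp x y) (perp x y) = 1 by rewrite herm_perp xx yy xy; ring.
have zx : herm (perp x y) x = 0 by rewrite herm_conj xz rmorph0.
have zy : herm (perp x y) y = 0 by rewrite herm_conj yz rmorph0.
apply/andP; split; last first.
  by rewrite det_mx3_cycle det_mx3 zz.
apply/eqP/matrixP=> i j; rewrite mulmx_ctr; move: i j.
by elim/ord3_ind; elim/ord3_ind; rewrite !row_mx3 mxE //= ?xx ?yy ?xy ?yx ?xz ?yz ?zz ?zx ?zy.
Qed.

End Hermitian.

(** * The norm map and counting *)

Lemma frobq_rmorphism (F : finFieldType) (q : nat) :
    (exists p k : nat, [/\ prime p, (0 < k)%N & q = (p ^ k)%N]) ->
    #|F| = (q ^ 2)%N ->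
  exists conj : {rmorphism F -> F}, conj =1 frobq q.
Proof.
move=> [p [k [pr_p k0 ->]]]; rewrite -expnM => cF.
have pF := card_finPcharP cF pr_p.
have pk : [pchar F].-nat (p ^ k)%N by rewrite pnatX pnatE // pF.
have add : zmod_morphism (@frobq F (p ^ k)).
  by move=> x y; rewrite /frobq exprDn_pchar // exprNn_pchar.
have mul : monoid_morphism (@frobq F (p ^ k)).
  by split=> [|x y]; rewrite /frobq ?expr1n ?exprMn.
pose HA := GRing.isZmodMorphism.Build F F (@frobq F (p ^ k)) add.
pose HM := GRing.isMonoidMorphism.Build F F (@frobq F (p ^ k)) mul.
by exists (HB.pack_for {rmorphism F -> F} (@frobq F (p ^ k)) HA HM).
Qed.

Lemma expr_coprime_eq1 (F : fieldType) (l : F) m n :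
  coprime m n -> l ^+ m = 1 -> l ^+ n = 1 -> l = 1.
Proof.
case: m => [|m]; first by rewrite /coprime gcd0n => /eqP-> _; rewrite expr1.
move=> cmn lm ln; have [u v e _] := egcdnP n (ltn0Sn m).
have : l ^+ (u * m.+1) = l ^+ (v * n + 1) by rewrite e (eqP cmn).
by rewrite mulnC exprM lm expr1n exprD mulnC exprM ln expr1n mul1r expr1.
Qed.

Section NormCount.
Variables (F : finFieldType) (q : nat) (conj : {rmorphism F -> F}).
Hypothesis q_pp : exists p k : nat, [/\ prime p, (0 < k)%N & q = (p ^ k)%N].
Hypotheses (q_odd : odd q) (cF : #|F| = (q ^ 2)%N) (conjq : forall x, conj x = x ^+ q).

Let q_gt0 : (0 < q)%N. Proof. exact: odd_gt0. Qed.
Let q_gt1 : (1 < q)%N.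
Proof.
have := card_finRing_gt1 F; rewrite cF; move: q_gt0; case: (q) => [|[|]] //.
Qed.

Lemma conj_involutive : involutive conj.
Proof. by move=> x; rewrite !conjq -exprM mulnn -cF expf_card. Qed.

Lemma two_neq0 : 2%:R != 0 :> F.
Proof.
have [p [k [pr_p k0 eq]]] := q_pp.
have pF : p \in [pchar F] by apply: (@card_finPcharP F p (k * 2)); rewrite // expnM -eq.
apply/negP=> /eqP e; have : 2%N \in [pchar F] by rewrite inE /= e eqxx.
rewrite (pcharf_eq pF) inE => /eqP p2.
by move: q_odd; rewrite eq -p2 oddX /= orbF => /eqP k0'; rewrite k0' in k0.
Qed.

Lemma expr_unit (x : F) : x != 0 -> x ^+ (q ^ 2 - 1) = 1.
Proof.
move=> x0; apply: (mulfI x0); rewrite -exprS mulr1 subn1 prednK -?cF ?expf_card //.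
by rewrite cF expn_gt0 q_gt0.
Qed.

(** The norm of GF(q^2) over the subfield GF(q) fixed by [conj]. *)
Definition nrm (x : F) := x * conj x.

Lemma nrmE x : nrm x = x ^+ q.+1.
Proof. by rewrite /nrm conjq exprS. Qed.

Lemma nrmM x y : nrm (x * y) = nrm x * nrm y.
Proof. by rewrite /nrm rmorphM mulrACA. Qed.

Lemma nrmV x : nrm x^-1 = (nrm x)^-1.
Proof. by rewrite /nrm fmorphV invfM. Qed.

Lemma conj_nrm x : conj (nrm x) = nrm x.
Proof. by rewrite /nrm rmorphM conj_involutive mulrC. Qed.

Lemma nrm_eq0 x : (nrm x == 0) = (x == 0).
Proof. by rewrite nrmE expf_eq0. Qed.

Lemma card_roots_le n c : (0 < n)%N -> (#|[set t : F | t ^+ n == c]| <= n)%N.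
Proof.
move=> n0; have sz : size ('X^n - c%:P) = n.+1 by rewrite size_XnsubC.
rewrite -ltnS -sz cardE; apply: max_poly_roots.
- by rewrite -size_poly_eq0 sz.
- by apply/allP=> t; rewrite mem_enum inE rootE !hornerE => /eqP->; rewrite subrr.
- exact: enum_uniq.
Qed.

(** At most [q - 1] nonzero elements are fixed by [conj], each with at most [q + 1] preimages, and
    these preimages exhaust the [q ^ 2 - 1] nonzero elements; so all bounds are attained. *)
Lemma card_nrm c : conj c = c -> c != 0 -> #|[set t | nrm t == c]| = q.+1.
Proof.
pose Fx := [set c : F | c ^+ q.-1 == 1].
have q1 : q.-1.+1 = q by rewrite prednK.
have FxP x : (x \in Fx) = (conj x == x) && (x != 0).
  rewrite inE conjq; have [->|x0] := eqVneq x 0.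
    by rewrite expr0n; case: (q) q_gt1 => [|[|]] //= n _; rewrite eq_sym oner_eq0 andbF.
  rewrite andbT -[in X in X == x]q1 exprS.
  by apply/eqP/eqP => [->|e]; [rewrite mulr1 | apply: (mulfI x0); rewrite e mulr1].
have cFx : (#|Fx| <= q.-1)%N by apply: card_roots_le; rewrite -subn1 subn_gt0.
have le c' : c' \in Fx -> (#|[set t | nrm t == c']| <= q.+1 ?= iff (#|[set t | nrm t == c']| == q.+1))%N.
  move=> _; split=> //; rewrite (eq_card (_ : _ =i [set t | t ^+ q.+1 == c'])) ?card_roots_le //.
  by move=> t; rewrite !inE nrmE.
have [le1 eq1] := leqif_sum le.
have tot : (\sum_(c' in Fx) #|[set t | nrm t == c']| = q.+1 * q.-1)%N.
  have <- : #|[set t : F | t != 0]| = (q.+1 * q.-1)%N.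
    rewrite (eq_card (_ : _ =i predC1 0)) ?cardC1 ?cF; last by move=> t; rewrite !inE.
    by move: q_gt0; rewrite -mulnn -!subn1; case: (q) => // n _; nia.
  rewrite -[RHS]sum1_card [RHS](partition_big nrm [in Fx]) /=; last first.
    by move=> t; rewrite inE => t0; rewrite FxP conj_nrm eqxx nrm_eq0.
  apply: eq_bigr => c'; rewrite FxP => /andP[_ c0]; rewrite -sum1_card.
  apply: eq_bigl => t; rewrite !inE -nrm_eq0; case: eqVneq => [->|]; last by rewrite andbF.
  by rewrite c0.
have : [forall (c' | c' \in Fx), #|[set t | nrm t == c']| == q.+1].
  by rewrite -eq1 eqn_leq le1 /= tot sum_nat_const [leqRHS]mulnC leq_mul2r cFx orbT.
by move/forall_inP=> all cc c0; apply/eqP/all; rewrite FxP cc eqxx c0.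
Qed.

Lemma nrm_surj c : conj c = c -> exists t, nrm t = c.
Proof.
move=> cc; have [->|c0] := eqVneq c 0; first by exists 0; rewrite /nrm mul0r.
have /card_gt0P[t] : (0 < #|[set t | nrm t == c]|)%N by rewrite card_nrm.
by rewrite inE => /eqP; exists t.
Qed.

(** If [conj] were trivial, the norm would be squaring and 1 would have [q + 1 > 2] square roots.
    Any [t] moved by [conj] yields [t - conj t]. *)
Lemma exists_skew : exists2 d, d != 0 & conj d = - d.
Proof.
have [/forallP all|/forallPn[t nt]] := boolP [forall t, conj t == t].
  have := card_nrm (rmorph1 conj) (oner_neq0 F); have := @card_roots_le 2 1 isT.
  rewrite (eq_card (_ : _ =i [set t | nrm t == 1])) => [le2 e|t].
    by move: le2; rewrite e ltnS leqNgt q_gt1.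
  by rewrite !inE /nrm (eqP (all t)) -expr2.
exists (t - conj t); first by rewrite subr_eq0 eq_sym.
by rewrite rmorphB conj_involutive opprB.
Qed.

(** Each [c - nrm x] has [q + 1] preimages under the norm, except that 0 has only one; the second
    term makes up the deficit [q] at each [x] with [nrm x = c]. *)
Lemma sum_nrm c : conj c = c ->
  (\sum_x #|[set t | nrm t == (c - nrm x)%R]| + q * #|[set t | nrm t == c]| = q ^ 2 * q.+1)%N.
Proof.
move=> cc; have nu c' : conj c' = c' -> (#|[set t | nrm t == c']| + q * (c' == 0)%R = q.+1)%N.
  move=> cc'; have [->|c0] := eqVneq c' 0; last by rewrite muln0 addn0 card_nrm.
  rewrite muln1 (eq_card (_ : _ =i pred1 0)) ?card1 // => t.
  by rewrite !inE nrm_eq0.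
have -> : #|[set t | nrm t == c]| = (\sum_x ((c - nrm x == 0)%R : nat))%N.
  rewrite -sum1dep_card big_mkcond /=; apply: eq_bigr => x _.
  by rewrite subr_eq0 eq_sym; case: eqP.
rewrite big_distrr -big_split /= -cF -sum_nat_const; apply: eq_bigr => x _.
by rewrite nu // rmorphB cc conj_nrm.
Qed.

Lemma card_nrm2 c :
  #|[set u : F * F | (nrm u.1 + nrm u.2 == c)%R]| = (\sum_x #|[set t | nrm t == (c - nrm x)%R]|)%N.
Proof.
rewrite -sum1_card (partition_big fst xpredT) //=; apply: eq_bigr => x _.
rewrite sum1_card -(card_imset [set t | nrm t == (c - nrm x)%R] (_ : injective (pair x)));
  last by move=> ? ? [].
apply: eq_card => -[x' t]; apply/andP/imsetP => [[]|[t']]; rewrite !inE /=.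
  by move=> /eqP e /eqP e'; exists t; rewrite ?inE -?e -?e' // addrC addKr.
by move=> /eqP e [-> ->]; rewrite e addrC subrK.
Qed.

(** Splitting off the first coordinate leaves pairs, counted by [sum_nrm], which is used once more
    for the outer sum. Terms stand on both sides to avoid truncated subtraction. *)
Lemma card_herm c : conj c = c ->
  (#|[set v | herm conj v v == c]| + q ^ 4 + q ^ 3
     = q ^ 5 + q ^ 4 + q ^ 2 * #|[set t | nrm t == c]|)%N.
Proof.
move=> cc.
pose P c' := #|[set u : F * F | (nrm u.1 + nrm u.2 == c')%R]|.
have -> : #|[set v | herm conj v v == c]| = (\sum_x P (c - nrm x)%R)%N.
  rewrite -sum1_card (partition_big (fun v : 'rV_3 => v 0 i0) xpredT) //=; apply: eq_bigr => x _.
  rewrite sum1_card /P -(card_imset _ (_ : injective (fun u => vec3 x u.1 u.2))); last first.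
    move=> [a b] [a' b'] /= e.
    move: (congr1 (fun v : 'rV_3 => v 0 i1) e) (congr1 (fun v : 'rV_3 => v 0 i2) e).
    by rewrite !vec3E => -> ->.
  apply: eq_card => v; apply/andP/imsetP => [[]|[[a b]]]; rewrite !inE /=.
    move=> /eqP e /eqP e'; exists (v 0 i1, v 0 i2); last by apply: vec3P; rewrite vec3E.
    by rewrite inE /= -e -e' /herm /nrm; apply/eqP; ring.
  by move=> /eqP e ->; rewrite !vec3E eqxx /herm !vec3E -!/(nrm _) -addrA e addrC subrK.
have S1 : (\sum_x (P (c - nrm x)%R + q * #|[set t | nrm t == (c - nrm x)%R]|) = q ^ 2 * (q ^ 2 * q.+1))%N.
  rewrite -{1}cF -sum_nat_const; apply: eq_bigr => x _.
  by rewrite /P card_nrm2 sum_nrm // rmorphB cc conj_nrm.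
move: S1 (sum_nrm cc); rewrite big_split -big_distrr /=.
set T := (\sum_x P _)%N; set U := (\sum_x _)%N; set v := #|_|; nia.
Qed.

End NormCount.

(** * Stabilizers of isotropic points *)

Section Action.
Variable F : finFieldType.
Implicit Types (u v : 'rV[F]_3) (g : {'GL_3[F]}).

Definition vact v g : 'rV[F]_3 := v *m GLval g.

Lemma vact1 v : vact v 1%g = v.
Proof. by rewrite /vact GL_1E mulmx1. Qed.

Lemma vactM v g g' : vact v (g * g')%g = vact (vact v g) g'.
Proof. by rewrite /vact GL_ME mulmxA. Qed.

Definition vaction := TotalAction vact1 vactM.

Lemma vactD u v g : vact (u + v) g = vact u g + vact v g.
Proof. exact: mulmxDl. Qed.
Lemma vactN u g : vact (- u) g = - vact u g.
Proof. exact: mulNmx. Qed.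
Lemma vactZ a u g : vact (a *: u) g = a *: vact u g.
Proof. by rewrite /vact scalemxAl. Qed.
Lemma vact0 g : vact 0 g = 0.
Proof. exact: mul0mx. Qed.
Definition vactE := (vactD, vactN, vactZ).

Lemma vactK g : cancel (vact^~ g) (vact^~ g^-1%g).
Proof. by move=> v; rewrite -vactM mulgV vact1. Qed.

Lemma vact_inj g : injective (vact^~ g).
Proof. exact: can_inj (vactK g). Qed.

Lemma vact_eq0 v g : (vact v g == 0) = (v == 0).
Proof.
apply/eqP/eqP => [|->]; last exact: vact0.
by rewrite -{1}(vact0 g) => /vact_inj.
Qed.

Lemma scale_inj v : v != 0 -> injective (fun a => a *: v).
Proof.
move=> v0 a b /eqP; rewrite -subr_eq0 -scalerBl scaler_eq0 (negbTE v0) orbF.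
by rewrite subr_eq0 => /eqP.
Qed.

(** A projective point as the set of its vectors, zero included, so that its stabilizer is
    ['N(line v | _)] for the action on vectors. *)
Definition line v : {set 'rV[F]_3} := [set a *: v | a : F].

Lemma lineP v g : reflect (exists a, vact v g = a *: v) (g \in 'N(line v | vaction))%g.
Proof.
have lv : v \in line v by apply/imsetP; exists 1; rewrite ?scale1r.
apply: (iffP idP) => [Ng|[a va]].
  have : vaction v g \in line v by rewrite astabs_act.
  by case/imsetP=> a _ e; exists a.
rewrite !inE /=; apply/subsetP=> _ /imsetP[b _ ->].
by rewrite inE /= vactZ va scalerA; apply/imsetP; exists (b * a).
Qed.

Lemma stab1P v g : reflect (vact v g = v) (g \in 'C[v | vaction])%g.
Proof. by apply: (iffP astab1P). Qed.

Lemma commg_fixes v g g' : vact v (g * g') = vact v (g' * g) ->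
  vact (vact v (g' * g)) [~ g, g'] = vact v (g' * g).
Proof. by move=> e; rewrite -vactM -commgC. Qed.

End Action.

Section SU3.
Variables (F : finFieldType) (q : nat) (conj : {rmorphism F -> F}).
Hypothesis q_pp : exists p k : nat, [/\ prime p, (0 < k)%N & q = (p ^ k)%N].
Hypotheses (q_odd : odd q) (cF : #|F| = (q ^ 2)%N) (conjq : forall x, conj x = x ^+ q).
Let conjK := conj_involutive cF conjq.
Let n2 := two_neq0 q_pp q_odd cF.
Local Notation G := (SU3 F q).
Local Notation h := (herm conj).
Local Notation perp := (perp conj).
Local Notation to := (vaction F).
Local Notation nrm := (nrm conj).

Lemma SU3E g : (g \in G) = SU conj (GLval g).
Proof.
have E u : (u \in SU3_set F q) = SU conj (GLval u).
  by rewrite inE /SU /ctrmx (eq_map_mx _ (conjq : conj =1 frobq q)).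
suff gS : group_set (SU3_set F q) by rewrite /SU3 /= (gen_set_id gS).
apply/group_setP; split=> [|x y]; rewrite !E.
  by rewrite /SU GL_1E ctrmx1 mulmx1 det1 !eqxx.
case/andP=> /eqP xx /eqP dx /andP[/eqP yy /eqP dy].
by rewrite /SU GL_ME ctrmxM mulmxA -(mulmxA (GLval x)) yy mulmx1 xx det_mulmx dx dy mulr1 !eqxx.
Qed.

Lemma SU_lift A : SU conj A -> exists2 g, g \in G & GLval g = A.
Proof.
move=> suA; have uA : (A : 'M_3.-1.+1) \is a GRing.unit.
  by have /andP[_ /eqP d] := suA; rewrite -[_ \is a _]/(_ \in unitmx) unitmxE d unitr1.
by exists (FinRing.unit _ uA); rewrite ?SU3E.
Qed.

Lemma vact_herm g u v : g \in G -> h (vact u g) (vact v g) = h u v.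
Proof. by rewrite SU3E; apply: SU_herm. Qed.

Lemma vact_perp g u v : g \in G -> perp (vact u g) (vact v g) = vact (perp u v) g.
Proof. by rewrite SU3E; apply: SU_perp. Qed.

Lemma vact_hyp_transitive x y x' y' : hyperbolic conj x y -> hyperbolic conj x' y' ->
  exists g, [/\ g \in G, vact x g = x' & vact y g = y'].
Proof.
move=> h1 h2; have [A [/SU_lift[g Gg <-] ex ey]] := hyp_transitive conjK h1 h2.
by exists g.
Qed.

Lemma hyp_partner x : h x x = 0 -> x != 0 -> exists y, hyperbolic conj x y.
Proof.
move=> xx x0; have [w xw] : exists w, h x w != 0.
  apply/existsP; rewrite -negb_forall; apply: contra x0 => /forallP all.
  apply/eqP/(herm_nondeg conjK) => w; rewrite (herm_conj conjK).
  by rewrite (eqP (all w)) rmorph0.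
pose A := h x w; pose W := h w w.
have cW : conj W = W by rewrite /W -herm_conj.
have wx : h w x = conj A by rewrite -herm_conj.
have A0 : conj A != 0 by rewrite fmorph_eq0.
(* With this [t] the cross terms of [h (w + t *: x) (w + t *: x)] are [- W / 2] each and cancel
   [h w w]; odd characteristic enters here. *)
pose t := - W / (2%:R * A).
have ct : conj t = - W / (2%:R * conj A) by rewrite !(rmorphM, fmorphV, rmorphN) rmorph_nat cW.
exists (conj A^-1 *: (w + t *: x)); split=> //.
  rewrite !hermE -/W -/A wx xx ct conjK.
  by rewrite /t fmorphV; field; rewrite n2 A0 xw.
by rewrite !hermE -/A xx conjK; field.
Qed.

(** There is no totally isotropic plane: if [h x y = 0], then [y] is a combination of [x] and
    [z = perp x y'], and [h y y = 0] kills its [z] part because [h z z = -1]. *)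
Lemma isotropic_pair x y : h x x = 0 -> h y y = 0 -> x != 0 ->
  (forall a, y != a *: x) -> h x y != 0.
Proof.
move=> xx yy x0 nxy; apply/negP=> /eqP xy.
have [y' hxy'] := hyp_partner xx x0; have hE := hyp_herm conjK hxy'.
have yx : h y x = 0 by rewrite (herm_conj conjK) xy rmorph0.
have dy := hyp_decomp conjK hxy' y; rewrite yx scale0r addr0 in dy.
have yz0 : h y (perp x y') = 0.
  move: yy; rewrite {1 2}dy !hermE !hE => e.
  apply/eqP; rewrite -(nrm_eq0 conjq) /nrm; apply/eqP.
  by rewrite -[RHS]oppr0 -[in RHS]e; ring.
by move: (nxy (h y y')); rewrite {1}dy yz0 scale0r subr0 eqxx.
Qed.

Section Hyperbolic.
Variables x y : 'rV[F]_3.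
Hypothesis hyp_xy : hyperbolic conj x y.
Let z := perp x y.
Let hE := hyp_herm conjK hyp_xy.

(** In order: a Borel subgroup, its unipotent radical, and the transvections with center [x]. *)
Definition isoB := ('N_G(line x | to))%G.
Definition isoQ := ('C_G[x | to])%G.
Definition isoZ := ('C_G[x | to] :&: 'C[z | to])%G.

Lemma x_neq0 : x != 0.
Proof.
by apply/negP=> /eqP x0; have := hE.1.1.1.1.1.1.1.2; rewrite x0 herm0l => /esym/eqP; rewrite oner_eq0.
Qed.

Lemma hyp_perp_perp : perp x z = x.
Proof. by rewrite perp_perp // !hE scale1r scale0r subr0. Qed.

Lemma isoQ_z g : g \in isoQ -> exists a, vact z g = z + a *: x.
Proof.
case/setIP=> Gg /stab1P xg.
have ygx : h (vact y g) x = 1 by rewrite -{1}xg vact_herm ?hE.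
have dy := hyp_decomp conjK hyp_xy (vact y g).
exists (- conj (h (vact y g) z)).
rewrite -[LHS]vact_perp // xg [in LHS]dy ygx scale1r -scaleNr !(perpDr, perpZr).
by rewrite perpxx hyp_perp_perp scaler0 add0r rmorphN addrC.
Qed.

Lemma isoZ_y g : g \in isoZ -> exists c, vact y g = y + c *: x.
Proof.
case/setIP=> /setIP[Gg /stab1P xg] /stab1P zg.
have ygx : h (vact y g) x = 1 by rewrite -{1}xg vact_herm ?hE.
have ygz : h (vact y g) z = 0 by rewrite -{1}zg vact_herm ?hE.
exists (h (vact y g) y); rewrite {1}(hyp_decomp conjK hyp_xy (vact y g)).
by rewrite ygx ygz scale0r scale1r subr0 addrC.
Qed.

Lemma hyp_act_ext g : vact x g = x -> vact z g = z -> vact y g = y -> g = 1%g.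
Proof.
move=> xg zg yg; have e : GLval g = 1%:M by apply: (hyp_mx_ext conjK hyp_xy); rewrite mulmx1.
by apply: val_inj; exact: e.
Qed.

(** Along the chain [isoB], [isoQ], [isoZ], 1 the groups act on [x] by scalars, then on [z] and
    finally on [y] by translations along [x]. These actions commute, so each derived subgroup lies
    in the next term. *)
Lemma isoB_solvable : solvable isoB.
Proof.
have BQ : (isoB^`(1) \subset isoQ)%g.
  rewrite derg1 gen_subG; apply/subsetP=> _ /imset2P[a b Ba Bb ->].
  have Gab : [~ a, b]%g \in G by rewrite groupR //; [case/setIP: Ba | case/setIP: Bb].
  rewrite inE Gab; apply/stab1P.
  have [/setIP[_ /lineP[r xa]] /setIP[_ /lineP[s xb]]] := (Ba, Bb).
  have e : vact x (a * b)%g = vact x (b * a)%g.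
    by rewrite !vactM xa xb !vactE xa xb !scalerA mulrC.
  have := commg_fixes e; rewrite vactM xb !vactE xa !vactE !scalerA => e'.
  have sr0 : s * r != 0.
    apply: contra x_neq0 => /eqP sr; rewrite -(vact_eq0 x (b * a)).
    by rewrite vactM xb vactE xa scalerA sr scale0r.
  by apply: (scalerI sr0).
have QZ : (isoQ^`(1) \subset isoZ)%g.
  rewrite derg1 gen_subG; apply/subsetP=> _ /imset2P[a b Qa Qb ->].
  have Qab : [~ a, b]%g \in isoQ by rewrite groupR.
  rewrite inE Qab; apply/stab1P.
  have [[r za] [s zb]] := (isoQ_z Qa, isoQ_z Qb).
  have [/setIP[_ /stab1P xa] /setIP[_ /stab1P xb]] := (Qa, Qb).
  have e : vact z (a * b)%g = vact z (b * a)%g.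
    by rewrite !vactM za zb !vactE za zb xa xb addrAC.
  have := commg_fixes e; rewrite vactM zb !vactE za xa !vactE.
  by case/setIP: Qab => _ /stab1P -> /addIr; apply: addIr.
have Z1 : (isoZ^`(1) \subset [1 {'GL_3[F]}])%g.
  rewrite derg1 gen_subG; apply/subsetP=> _ /imset2P[a b Za Zb ->].
  have /setIP[/setIP[_ /stab1P xab] /stab1P zab] : [~ a, b]%g \in isoZ by rewrite groupR.
  have [[r ya] [s yb]] := (isoZ_y Za, isoZ_y Zb).
  have [/setIP[/setIP[_ /stab1P xa] _] /setIP[/setIP[_ /stab1P xb] _]] := (Za, Zb).
  have e : vact y (a * b)%g = vact y (b * a)%g.
    by rewrite !vactM ya yb !vactE ya yb xa xb addrAC.
  rewrite inE; apply/eqP; apply: hyp_act_ext => //.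
  have := commg_fixes e; rewrite vactM yb !vactE ya xa !vactE xab.
  by move/addIr; apply: addIr.
have BZ : (isoB^`(2) \subset isoZ)%g.
  by apply: subset_trans QZ; rewrite dergSn [in X in _ \subset X]derg1 commgSS.
have B3 : (isoB^`(3) \subset isoZ^`(1))%g.
  by rewrite dergSn [in X in _ \subset X]derg1 commgSS.
by apply/derivedP; exists 3; apply/trivgP; apply: subset_trans B3 Z1.
Qed.

Lemma isoZ_normal : (isoZ <| isoQ)%g.
Proof.
rewrite /normal subsetIl; apply/normsP=> g Qg; apply/eqP.
rewrite eqEcard cardJg leqnn andbT; apply/subsetP=> _ /imsetP[k Zk ->].
have /setIP[Qk /stab1P zk] := Zk.
rewrite inE groupJ //; apply/stab1P.
have [a zg] := isoQ_z (groupVr Qg); have /setIP[_ /stab1P xk] := Qk.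
by rewrite conjgE !vactM zg !vactE xk zk -vactZ -vactD -zg -vactM mulVg vact1.
Qed.

Lemma card_isoQ : #|isoQ| = (q ^ 2 * #|isoZ|)%N.
Proof.
have -> : (isoZ : {set _}) = 'C_isoQ[z | to]%g by [].
rewrite -(card_orbit_stab to isoQ z); congr (_ * _)%N.
have -> : orbit to isoQ z = [set z + a *: x | a : F].
  apply/setP=> v; apply/orbitP/imsetP => [[g Qg <-]|[a _ ->]].
    by have [a e] := isoQ_z Qg; exists a.
  (* [perp x y'] is [z + conj b *: x], whence [b]; the multiple of [x] in [y'] restores isotropy. *)
  pose b := conj a; pose y' := y + b *: z + (nrm b / 2%:R) *: x.
  have hxy' : hyperbolic conj x y'.
    split; rewrite ?hE // /y' !hermE !hE ?mulr0 ?addr0 //.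
    have -> : conj (nrm b / 2%:R) = nrm b / 2%:R.
      by rewrite rmorphM fmorphV rmorph_nat (conj_nrm cF conjq).
    rewrite /nrm; field; exact: n2.
  have [g [Gg xg yg]] := vact_hyp_transitive hyp_xy hxy'.
  exists g; first by rewrite inE Gg; apply/stab1P.
  rewrite /= -[LHS]vact_perp // xg yg /y' !(perpDr, perpZr) perpxx hyp_perp_perp.
  by rewrite scaler0 addr0 conjK.
by rewrite card_imset ?cF // => a a' /addrI/(scale_inj x_neq0).
Qed.

(** With [vact z g = z + a *: x], the claim is [a = 0]. If [h v x = 0], then [v] is in the span of
    [x] and [z], and coefficients are compared; otherwise pairing with [x] gives [l = 1], and
    pairing with [z] gives [conj a * h v x = 0]. *)
Lemma nonisotropic_isoQ v g :
  h v v = 1 -> g \in isoQ -> g \in ('N(line v | to))%g -> g \in isoZ.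
Proof.
move=> vv Qg /lineP[l vg]; have [a zg] := isoQ_z Qg.
rewrite inE Qg; apply/stab1P; rewrite zg.
have /setIP[Gg /stab1P xg] := Qg.
suff -> : a = 0 by rewrite scale0r addr0.
have [vx|vx] := eqVneq (h v x) 0.
  have dv := hyp_decomp conjK hyp_xy v; rewrite vx scale0r addr0 in dv.
  have vz : h v z != 0.
    apply: contraTneq isT => vz; move: vv; rewrite dv -/z vz scale0r subr0.
    by rewrite !hermE !hE !mulr0 => /esym/eqP; rewrite oner_eq0.
  move: vg; rewrite dv !vactE xg -/z zg => vg.
  have := congr1 (fun u => h u z) vg; have := congr1 (fun u => h u y) vg.
  rewrite !hermE !hE => e1 e2.
  move: e1 e2; rewrite !mulr1 !mulr0 !addr0 add0r subr0 !sub0r !mulrN1 !opprK => e1 e2.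
  have l1 : l = 1 by apply: (mulIf vz); rewrite mul1r -e2.
  move/eqP: e1; rewrite l1 mul1r -subr_eq0 addrAC subrr add0r oppr_eq0 mulf_eq0.
  by rewrite (negbTE vz) => /eqP.
have l1 : l = 1 by apply: (mulIf vx); rewrite mul1r -hermZl -vg -{1}xg vact_herm.
have := vact_herm v z Gg; rewrite vg l1 scale1r zg !hermE => /eqP.
by rewrite -subr_eq0 addrC addKr mulf_eq0 fmorph_eq0 (negbTE vx) orbF => /eqP.
Qed.

(** The eigenvalue on [x] is an [n]-th root of unity and a [(q ^ 2 - 1)]-th one, hence 1. Then
    [g ^+ n] displaces [z], and after that [y], by [n] times what [g] does, and [n] is invertible in
    [F]. *)
Lemma isoB_coprime n g :
  coprime n (q * (q ^ 2 - 1)) -> g \in isoB -> (g ^+ n = 1)%g -> g = 1%g.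
Proof.
rewrite coprimeMr => /andP[cnq cnq2] /setIP[Gg /lineP[l xg]] gn1.
have iter v w a : vact v g = v + a *: w -> vact w g = w ->
    forall m, vact v (g ^+ m)%g = v + (m%:R * a) *: w.
  move=> vg wg; elim=> [|m IH]; first by rewrite expg0 vact1 mul0r scale0r addr0.
  by rewrite expgSr vactM IH !vactE vg wg -addrA -scalerDl -natr1 mulrDl mul1r [a + _]addrC.
have n0 : n%:R != 0 :> F.
  have [p [k [pr_p k0 eq]]] := q_pp.
  have pF : p \in [pchar F] by apply: (@card_finPcharP F p (k * 2)); rewrite // expnM -eq.
  by rewrite -(dvdn_pcharf pF) -prime_coprime // coprime_sym -(coprime_pexpr _ _ k0) -eq.
have fixed v w a : w != 0 -> vact v g = v + a *: w -> vact w g = w -> vact v g = v.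
  move=> w0 vg wg; have := iter _ _ _ vg wg n; rewrite gn1 vact1 => /eqP.
  rewrite eq_sym -subr_eq0 addrC addKr scaler_eq0 (negbTE w0) orbF mulf_eq0 (negbTE n0) /=.
  by rewrite vg => /eqP->; rewrite scale0r addr0.
have x0 := x_neq0.
have xg1 : vact x g = x.
  have iterx m : vact x (g ^+ m)%g = l ^+ m *: x.
    elim: m => [|m IH]; first by rewrite expg0 vact1 expr0 scale1r.
    by rewrite expgSr vactM IH vactE xg scalerA exprSr.
  have ln : l ^+ n = 1.
    by apply: (scale_inj x0); rewrite /= -iterx gn1 vact1 scale1r.
  have l0 : l != 0.
    by apply: contraNneq x0 => l0; rewrite -(vact_eq0 x g) xg l0 scale0r.
  by rewrite xg (expr_coprime_eq1 cnq2 ln) ?scale1r // (expr_unit q_odd cF).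
have Qg : g \in isoQ by rewrite inE Gg; apply/stab1P.
have [a zg] := isoQ_z Qg; have zg1 := fixed _ _ _ x0 zg xg1.
have Zg : g \in isoZ by rewrite inE Qg; apply/stab1P.
by have [c yg] := isoZ_y Zg; have yg1 := fixed _ _ _ x0 yg xg1; apply: hyp_act_ext.
Qed.

End Hyperbolic.
End SU3.

(** * Orthonormal bases, nonisotropic points and orbit sizes *)

Section Points.
Variables (F : finFieldType) (q : nat) (conj : {rmorphism F -> F}).
Hypothesis q_pp : exists p k : nat, [/\ prime p, (0 < k)%N & q = (p ^ k)%N].
Hypotheses (q_odd : odd q) (cF : #|F| = (q ^ 2)%N) (conjq : forall x, conj x = x ^+ q).
Let conjK := conj_involutive cF conjq.
Let n2 := two_neq0 q_pp q_odd cF.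
Local Notation G := (SU3 F q).
Local Notation h := (herm conj).
Local Notation perp := (perp conj).
Local Notation to := (vaction F).
Local Notation nrm := (nrm conj).
Let SU3E := SU3E conjq.
Let SU_lift := SU_lift conjq.

Definition e1 : 'rV[F]_3 := vec3 1 0 0.
Definition e2 : 'rV[F]_3 := vec3 0 1 0.
Definition e3 : 'rV[F]_3 := vec3 0 0 1.

Lemma vec3_decomp (v : 'rV[F]_3) : v = v 0 i0 *: e1 + v 0 i1 *: e2 + v 0 i2 *: e3.
Proof. by apply: vec3P; rewrite !mxE /=; ring. Qed.

Lemma vec3_mx3 a b c (u v w : 'rV[F]_3) :
  vec3 a b c *m mx3 u v w = a *: u + b *: v + c *: w.
Proof. by apply/rowP=> j; rewrite !mxE sum3E !mxE. Qed.

Lemma vec3_neq0 (v : 'rV[F]_3) i : v 0 i != 0 -> v != 0.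
Proof. by apply: contraNneq => ->; rewrite mxE. Qed.

Lemma basis_ext (g : {'GL_3[F]}) :
  vact e1 g = e1 -> vact e2 g = e2 -> vact e3 g = e3 -> g = 1%g.
Proof.
move=> g1 g2 g3; have e : GLval g = 1%:M; last by apply: val_inj; exact: e.
have fix_all v : vact v g = v by rewrite (vec3_decomp v) !vactE g1 g2 g3.
by apply/row_matrixP=> i; rewrite !rowE mulmx1; apply: fix_all.
Qed.

Definition dgm (a b c : F) : 'M[F]_3 := mx3 (vec3 a 0 0) (vec3 0 b 0) (vec3 0 0 c).

Lemma dgm_lift a b c : nrm a = 1 -> nrm b = 1 -> nrm c = 1 -> a * b * c = 1 ->
  exists2 g, g \in G & forall v, vact v g = vec3 (v 0 i0 * a) (v 0 i1 * b) (v 0 i2 * c).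
Proof.
move=> na nb nc abc; have su : SU conj (dgm a b c).
  apply/andP; split; last by rewrite det3E !mxE /= -abc; apply/eqP; ring.
  apply/eqP/matrixP=> i j; rewrite mulmx_ctr; move: i j.
  elim/ord3_ind; elim/ord3_ind; rewrite !row_mx3 /herm !vec3E [RHS]mxE /= !rmorph0;
    by rewrite -?/(nrm _) ?na ?nb ?nc; ring.
have [g Gg gE] := SU_lift su; exists g => // v.
rewrite /vact gE {1}(vec3_decomp v) !mulmxDl -!scalemxAl !vec3_mx3.
by apply: vec3P; rewrite !mxE /=; ring.
Qed.

Lemma swap_lift : exists2 g, g \in G & vact e1 g = e2 /\ vact e2 g = - e1.
Proof.
have su : SU conj (mx3 e2 (- e1) e3).
  apply/andP; split; last by rewrite det3E !mxE /=; apply/eqP; ring.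
  apply/eqP/matrixP=> i j; rewrite mulmx_ctr; move: i j.
  by elim/ord3_ind; elim/ord3_ind; rewrite !row_mx3 /herm !mxE /= ?rmorphN !(rmorph0, rmorph1); ring.
have [g Gg gE] := SU_lift su; exists g => //.
by rewrite /vact gE !vec3_mx3 !scale0r !scale1r !addr0 !add0r.
Qed.

Lemma eq_oppr0 (a : F) : a = - a -> a = 0.
Proof.
move=> /eqP; rewrite -subr_eq0 opprK -mulr2n -mulr_natl mulf_eq0 (negbTE n2).
by move/eqP.
Qed.

(** Commuting with the diagonal matrices with entries 1, -1, -1 in some order makes each basis
    vector an eigenvector, as 2 is invertible; the swap identifies the first two eigenvalues. This
    puts the center inside the stabilizers of the points of [e3] and [x0]. *)
Lemma center_scalar g : g \in 'Z(G)%g ->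
  exists a c, [/\ vact e1 g = a *: e1, vact e2 g = a *: e2 & vact e3 g = c *: e3].
Proof.
case/setIP=> Gg /centP cg.
have com k v : k \in G -> vact (vact v g) k = vact (vact v k) g.
  by move=> Gk; rewrite -!vactM (cg k Gk).
have n1 : nrm 1 = 1 by rewrite /nrm rmorph1 mulr1.
have nN1 : nrm (-1) = 1 by rewrite /nrm rmorphN1 mulrNN mulr1.
have [||||t1 Gt1 t1E] := @dgm_lift 1 (-1) (-1); rewrite ?n1 ?nN1 //; first by ring.
have [||||t2 Gt2 t2E] := @dgm_lift (-1) 1 (-1); rewrite ?n1 ?nN1 //; first by ring.
have [||||t3 Gt3 t3E] := @dgm_lift (-1) (-1) 1; rewrite ?n1 ?nN1 //; first by ring.
have g1 : vact e1 g = vact e1 g 0 i0 *: e1.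
  have := com t1 e1 Gt1; rewrite !t1E !vec3E mul1r !mul0r -/e1 => e.
  have := congr1 (fun v : 'rV_3 => v 0 i1) e; have := congr1 (fun v : 'rV_3 => v 0 i2) e.
  rewrite !vec3E !mulrN1 => /esym/eq_oppr0 v2 /esym/eq_oppr0 v1.
  by apply: vec3P; rewrite [RHS]mxE vec3E ?mulr1 ?mulr0.
have g2 : vact e2 g = vact e2 g 0 i1 *: e2.
  have := com t2 e2 Gt2; rewrite !t2E !vec3E mul1r !mul0r -/e2 => e.
  have := congr1 (fun v : 'rV_3 => v 0 i0) e; have := congr1 (fun v : 'rV_3 => v 0 i2) e.
  rewrite !vec3E !mulrN1 => /esym/eq_oppr0 v2 /esym/eq_oppr0 v0.
  by apply: vec3P; rewrite [RHS]mxE vec3E ?mulr1 ?mulr0.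
have g3 : vact e3 g = vact e3 g 0 i2 *: e3.
  have := com t3 e3 Gt3; rewrite !t3E !vec3E mul1r !mul0r -/e3 => e.
  have := congr1 (fun v : 'rV_3 => v 0 i0) e; have := congr1 (fun v : 'rV_3 => v 0 i1) e.
  rewrite !vec3E !mulrN1 => /esym/eq_oppr0 v1 /esym/eq_oppr0 v0.
  by apply: vec3P; rewrite [RHS]mxE vec3E ?mulr1 ?mulr0.
have [s Gs [s1 s2]] := swap_lift.
exists (vact e1 g 0 i0), (vact e3 g 0 i2); split=> //.
have := com s e1 Gs; rewrite s1 => <-.
by rewrite {1}g1 vactZ s1.
Qed.

Lemma unit_transitive v : h v v = 1 -> exists2 g, g \in G & vact e3 g = v.
Proof.
move=> vv.
have [w vw ww] : exists2 w, h v w = 0 & h w w != 0.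
  (* These three vectors are orthogonal to [v], and their values [h w w] add up to [2 h v v], so
     they cannot all be isotropic. *)
  pose w1 := vec3 (conj (v 0 i1)) (- conj (v 0 i0)) 0.
  pose w2 := vec3 (conj (v 0 i2)) 0 (- conj (v 0 i0)).
  pose w3 := vec3 0 (conj (v 0 i2)) (- conj (v 0 i1)).
  have vw1 : h v w1 = 0 by rewrite /herm !vec3E !rmorphN !conjK rmorph0; ring.
  have vw2 : h v w2 = 0 by rewrite /herm !vec3E !rmorphN !conjK rmorph0; ring.
  have vw3 : h v w3 = 0 by rewrite /herm !vec3E !rmorphN !conjK rmorph0; ring.
  have [h1|] := eqVneq (h w1 w1) 0; last by exists w1.
  have [h2|] := eqVneq (h w2 w2) 0; last by exists w2.
  have [h3|] := eqVneq (h w3 w3) 0; last by exists w3.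
  move: (oner_neq0 F); rewrite -vv => /eqP[].
  move: h1 h2 h3; rewrite /herm !vec3E !rmorphN !conjK rmorph0 => h1 h2 h3.
  apply/eqP; rewrite -(mulrI_eq0 _ (mulfI n2)); apply/eqP.
  have := congr2 +%R (congr2 +%R h1 h2) h3; rewrite !addr0 => <-.
  by ring.
have [t tE] := nrm_surj q_odd cF conjq (esym (herm_conj conjK w w)).
have t0 : t != 0 by rewrite -(nrm_eq0 conjq) tE.
have cw : h (t^-1 *: w) (t^-1 *: w) = 1.
  by rewrite hermZl hermZr -tE /nrm fmorphV; field; rewrite fmorph_eq0 t0.
have cv : h v (t^-1 *: w) = 0 by rewrite hermZr vw mulr0.
have [g Gg gE] := SU_lift (orthonormal_SU conjK vv cw cv).
by exists g; rewrite // /vact gE vec3_mx3 !scale0r !add0r scale1r.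
Qed.

Lemma isotropic_transitive u v : h u u = 0 -> h v v = 0 -> u != 0 -> v != 0 ->
  exists2 g, g \in G & vact u g = v.
Proof.
move=> uu vv u0 v0; have [y huy] := hyp_partner q_pp q_odd cF conjq uu u0.
have [z hvz] := hyp_partner q_pp q_odd cF conjq vv v0.
by have [g [Gg <- _]] := vact_hyp_transitive cF conjq huy hvz; exists g.
Qed.

Definition stabR := ('N_G(line e3 | to))%G.

Lemma herm_e3 : h e3 e3 = 1.
Proof. by rewrite /herm !vec3E rmorph1; ring. Qed.

Lemma e3_neq0 : e3 != 0.
Proof. by apply: (@vec3_neq0 _ i2); rewrite vec3E oner_neq0. Qed.

(** [e3] has the same stabilizer in [G] and in [stabR], so the index is the ratio of its orbits: the
    [q ^ 5 + q ^ 2] vectors with [h v v = 1], and the [q + 1] multiples of [e3] by scalars of norm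
    1. *)
Lemma card_stabR : #|G| = (q ^ 2 * (q ^ 2 - q + 1) * #|stabR|)%N.
Proof.
have q0 := odd_gt0 q_odd.
have oG : orbit to G e3 = [set v | h v v == 1].
  apply/setP=> v; rewrite inE; apply/orbitP/eqP => [[g Gg <-]|/unit_transitive[g Gg <-]].
    by rewrite /= (vact_herm cF conjq) // herm_e3.
  by exists g.
have oR : orbit to stabR e3 = [set a *: e3 | a in [set a | nrm a == 1]].
  apply/setP=> v; apply/orbitP/imsetP => [[g /setIP[Gg /lineP[a ag]] <-]|[a]].
    exists a => //; rewrite inE; apply/eqP.
    have := vact_herm cF conjq e3 e3 Gg; rewrite ag hermZl hermZr herm_e3 => <-.
    by rewrite /nrm; ring.
  rewrite inE => /eqP na ->.
  have nV : nrm a^-1 = 1 by rewrite nrmV na invr1.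
  have a0 : a != 0 by rewrite -(nrm_eq0 conjq) na oner_neq0.
  have [||||g Gg gE] := @dgm_lift 1 a^-1 a => //; first by rewrite /nrm rmorph1 mulr1.
    by field.
  have ge : vact e3 g = a *: e3.
    by rewrite gE; apply: vec3P; rewrite !mxE /=; ring.
  by exists g => //; rewrite inE Gg; apply/lineP; exists a.
have cC : 'C_stabR[e3 | to]%g = 'C_G[e3 | to]%g.
  apply/setP=> g; apply/setIP/setIP=> [[/setIP[Gg _] ->]|[Gg cg]] //; split=> //.
  by rewrite inE Gg; apply/lineP; exists 1; rewrite scale1r; apply/stab1P.
have c1 := card_nrm q_odd cF conjq (rmorph1 conj) (oner_neq0 F).
rewrite -(card_orbit_stab to stabR e3) -(card_orbit_stab to G e3) cC oG oR.
rewrite card_imset ?c1; last exact: scale_inj e3_neq0.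
rewrite mulnA; congr (_ * _)%N.
have := card_herm q_odd cF conjq (rmorph1 conj); rewrite c1.
move: #|_| => N; move: q0; clear; nia.
Qed.

(** * An isotropic point orthogonal to [e3], and the factorization of [stabR] *)

Section IsotropicPoint.
Variable e : F.
Hypothesis ne : nrm e = -1.

Definition x0 : 'rV[F]_3 := vec3 1 e 0.
Definition y0 : 'rV[F]_3 := vec3 2%:R^-1 (- (e / 2%:R)) 0.

Lemma hyp0 : hyperbolic conj x0 y0.
Proof.
have ne' : e * conj e = -1 by [].
have c2 : conj 2%:R^-1 = 2%:R^-1 by rewrite fmorphV rmorph_nat.
have h2 : 2%:R^-1 + 2%:R^-1 = 1 :> F by field.
split; rewrite /herm !vec3E ?(rmorphN, rmorphM) ?rmorph0 ?rmorph1 ?c2.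
- by rewrite ne'; ring.
- rewrite (_ : - (e / 2%:R) * - (conj e / 2%:R) = e * conj e * (2%:R^-1 * 2%:R^-1)); last by ring.
  by rewrite ne'; ring.
rewrite (_ : e * - (conj e / 2%:R) = - (e * conj e * 2%:R^-1)); last by ring.
by rewrite ne' -[RHS]h2; ring.
Qed.

Definition stabB := isoB q x0.
Definition stabB0 := (stabR :&: 'N(line x0 | to))%G.
(** The torus of all diag(1, b, b^-1) with [nrm b = 1]. *)
Definition torusD := ('C_G[e1 | to] :&: 'N(line e2 | to) :&: 'N(line e3 | to))%G.

Lemma x0_neq0 : x0 != 0.
Proof. by apply: (@vec3_neq0 _ i0); rewrite vec3E oner_neq0. Qed.

Lemma x0E : x0 = e1 + e *: e2.
Proof. by apply: vec3P; rewrite !mxE /=; ring. Qed.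

Lemma card_stabB : #|G| = ((q ^ 3 + 1) * #|stabB|)%N.
Proof.
have q0 := odd_gt0 q_odd; have [xx _ _] := hyp0.
have oG : orbit to G x0 = [set v | h v v == 0] :\ 0.
  apply/setP=> v; rewrite !inE; apply/orbitP/andP => [[g Gg <-]|[v0 /eqP vv]].
    by rewrite /= (vact_herm cF conjq) // xx vact_eq0 x0_neq0.
  by have [g Gg <-] := isotropic_transitive xx vv x0_neq0 v0; exists g.
have oB : orbit to stabB x0 = [set a *: x0 | a in [set~ 0]].
  apply/setP=> v; apply/orbitP/imsetP => [[g /setIP[Gg /lineP[a ag]] <-]|[a]].
    exists a => //; rewrite !inE; apply: contra x0_neq0 => /eqP a0.
    by rewrite -(vact_eq0 x0 g) ag a0 scale0r.
  rewrite !inE => a0 ->.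
  have axax : h (a *: x0) (a *: x0) = 0 by rewrite hermZl hermZr xx !mulr0.
  have ax0 : a *: x0 != 0 by rewrite scaler_eq0 negb_or a0 x0_neq0.
  have [g Gg gE] := isotropic_transitive xx axax x0_neq0 ax0.
  by exists g => //; rewrite inE Gg; apply/lineP; exists a.
have cC : 'C_stabB[x0 | to]%g = 'C_G[x0 | to]%g.
  apply/setP=> g; apply/setIP/setIP=> [[/setIP[Gg _] ->]|[Gg cg]] //; split=> //.
  by rewrite inE Gg; apply/lineP; exists 1; rewrite scale1r; apply/stab1P.
rewrite -(card_orbit_stab to stabB x0) -(card_orbit_stab to G x0) cC oG oB.
rewrite card_imset ?cardsC1 ?cF; last exact: scale_inj x0_neq0.
rewrite mulnA; congr (_ * _)%N.
have := card_herm q_odd cF conjq (rmorph0 conj).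
have -> : #|[set t | nrm t == 0]| = 1%N.
  by rewrite (eq_card (_ : _ =i pred1 0)) ?card1 // => t; rewrite !inE (nrm_eq0 conjq).
rewrite (cardsD1 0) inE herm0l eqxx.
move: #|_| => N; move: q0; rewrite -subn1; clear; nia.
Qed.

Lemma stabR_fact : (stabB0 * torusD = stabR)%g /\ (stabB0 :&: torusD = 1)%g.
Proof.
split; last first.
  apply/trivgP/subsetP=> g /setIP[/setIP[_ /lineP[l xg]]].
  case/setIP=> /setIP[/setIP[Gg /stab1P g1] /lineP[b g2]] _.
  rewrite inE; apply/eqP.
  have := xg; rewrite {1}x0E vactE vactZ g1 g2 => eg.
  have := congr1 (fun v : 'rV_3 => v 0 i0) eg; rewrite !mxE /= => e0.
  have := congr1 (fun v : 'rV_3 => v 0 i1) eg; rewrite !mxE /= => e1'.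
  have l1 : l = 1 by rewrite mulr1 !mulr0 addr0 in e0.
  have e_neq0 : e != 0 by rewrite -(nrm_eq0 conjq) ne oppr_eq0 oner_neq0.
  have b1 : b = 1.
    by apply: (mulfI e_neq0); move: e1'; rewrite l1 !mulr1 add0r mul1r.
  have g2' : vact e2 g = e2 by rewrite g2 b1 scale1r.
  apply: basis_ext => //.
  have -> : e3 = perp e1 e2 by apply: vec3P; rewrite !vec3E !(rmorphB, rmorphM, rmorph0, rmorph1); ring.
  by rewrite -(vact_perp cF conjq) // g1 g2'.
apply/eqP; rewrite eqEsubset; apply/andP; split.
  rewrite mul_subG ?subsetIl //; apply/subsetP=> g /setIP[/setIP[/setIP[Gg _] _] N3].
  by rewrite inE Gg.
apply/subsetP=> r Rr; have /setIP[Gr /lineP[l r3]] := Rr.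
have [xx _ _] := hyp0.
pose v := vact x0 r.
have vv : h v v = 0 by rewrite (vact_herm cF conjq).
have l0 : l != 0.
  by apply: contra e3_neq0 => /eqP l0; rewrite -(vact_eq0 e3 r) r3 l0 scale0r.
have v2 : v 0 i2 = 0.
  have : h v (vact e3 r) = 0.
    by rewrite (vact_herm cF conjq) // /herm !vec3E !(rmorph0, rmorph1); ring.
  rewrite r3 hermZr => /eqP; rewrite mulf_eq0 fmorph_eq0 (negbTE l0) /= /herm !vec3E.
  by rewrite !rmorph0 rmorph1 !mulr0 !add0r mulr1 => /eqP.
have v01 : nrm (v 0 i0) = - nrm (v 0 i1).
  by apply/eqP; rewrite -subr_eq0 opprK -vv /herm v2 mul0r addr0.
have v0 : v 0 i0 != 0.
  have : v != 0 by rewrite vact_eq0 x0_neq0.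
  apply: contraNneq => v0; move: v01; rewrite v0 {1}/nrm mul0r => /esym/eqP.
  rewrite oppr_eq0 (nrm_eq0 conjq) => /eqP v1.
  by apply/eqP/vec3P; rewrite [RHS]mxE.
have e_neq0 : e != 0 by rewrite -(nrm_eq0 conjq) ne oppr_eq0 oner_neq0.
(* With this [b], diag(1, b, b^-1) sends [x0] to a multiple of [v], so [r * d^-1] fixes the point of
   [x0]. *)
pose b := v 0 i1 / (v 0 i0 * e).
have nb : nrm b = 1.
  rewrite /b nrmM nrmV nrmM v01 ne mulrN1 opprK divff // (nrm_eq0 conjq).
  apply: contra v0 => /eqP v1.
  by rewrite -(nrm_eq0 conjq) v01 v1 /nrm mul0r oppr0.
have nbV : nrm b^-1 = 1 by rewrite nrmV nb invr1.
have b0 : b != 0 by rewrite -(nrm_eq0 conjq) nb oner_neq0.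
have [||||d Gd dE] := @dgm_lift 1 b b^-1 => //; first by rewrite /nrm rmorph1 mulr1.
  by field.
have Dd : d \in torusD.
  apply/setIP; split; first (apply/setIP; split; first (apply/setIP; split=> //)).
  - by apply/stab1P; rewrite dE; apply: vec3P; rewrite !mxE /=; ring.
  - by apply/lineP; exists b; rewrite dE; apply: vec3P; rewrite !mxE /=; ring.
  - by apply/lineP; exists b^-1; rewrite dE; apply: vec3P; rewrite !mxE /=; ring.
have Rd : d \in stabR by rewrite inE Gd; case/setIP: Dd.
have -> : r = ((r * d^-1) * d)%g by rewrite mulgVK.
rewrite mem_mulg // inE groupM ?groupV //=; apply/lineP; exists (v 0 i0).
rewrite vactM -/v; apply: (@vact_inj _ d); rewrite -vactM mulVg vact1 vactZ dE.
apply: vec3P; rewrite [RHS]mxE !vec3E ?v2; [by ring| |by ring].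
by rewrite /b; field; rewrite e_neq0 v0.
Qed.

Lemma torusD_solvable : solvable torusD.
Proof.
apply: abelian_sol; apply/centsP=> a Da b Db.
case/setIP: Da => /setIP[/setIP[_ /stab1P a1] /lineP[r a2]] /lineP[s a3].
case/setIP: Db => /setIP[/setIP[_ /stab1P b1] /lineP[r' b2]] /lineP[s' b3].
apply: (mulIg (b * a)^-1%g); rewrite mulgV; apply: basis_ext.
- by apply: (@vact_inj _ (b * a)%g); rewrite -vactM mulgVK !vactM ?a1 ?b1 ?a1.
- by apply: (@vact_inj _ (b * a)%g); rewrite -vactM mulgVK !vactM a2 b2 !vactZ a2 b2 !scalerA mulrC.
- by apply: (@vact_inj _ (b * a)%g); rewrite -vactM mulgVK !vactM a3 b3 !vactZ a3 b3 !scalerA mulrC.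
Qed.

Lemma center_sub_stab : ('Z(G) \subset stabB)%g /\ ('Z(G) \subset stabB0)%g.
Proof.
suff cen g : g \in 'Z(G)%g -> g \in stabB0.
  split; apply/subsetP=> g /cen // /setIP[/setIP[Gg _] gx].
  by rewrite inE Gg.
move=> Zg; have [a [c [g1 g2 g3]]] := center_scalar Zg.
have Gg := subsetP (center_sub G) _ Zg.
apply/setIP; split; first apply/setIP; first split=> //; apply/lineP; first by exists c.
by exists a; rewrite x0E vactE vactZ g1 g2 scalerDr !scalerA mulrC.
Qed.

End IsotropicPoint.
End Points.

(** * The cyclic torus of order q^2 - q + 1 *)

Lemma cube_fact (q : nat) :
  (0 < q)%N -> (q ^ 3 + 1 = (q + 1) * (q ^ 2 - q + 1))%N.
Proof. by nia. Qed.

Section Singer.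
Variables (F : finFieldType) (q : nat) (conj : {rmorphism F -> F}).
Hypothesis q_pp : exists p k : nat, [/\ prime p, (0 < k)%N & q = (p ^ k)%N].
Hypotheses (q_odd : odd q) (cF : #|F| = (q ^ 2)%N) (conjq : forall x, conj x = x ^+ q).
Let conjK := conj_involutive cF conjq.
Let n2 := two_neq0 q_pp q_odd cF.
Local Notation G := (SU3 F q).
Local Notation h := (herm conj).
Local Notation to := (vaction F).
Local Notation nrm := (nrm conj).
Local Notation r := (q ^ 2 - q + 1)%N.
Local Notation ctrmx := (ctrmx conj).
Let SU3E := SU3E conjq.
Variable e : F.
Hypothesis ne : nrm e = -1.
Hypotheses (r_coprime : coprime r (q * (q ^ 2 - 1))) (r_gt1 : (1 < r)%N).

Let q_gt0 : (0 < q)%N := odd_gt0 q_odd.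

(** * The field generated by an element of prime order dividing [q ^ 2 - q + 1] *)

Section IrreducibleElement.
Variable (u : {'GL_3[F]}) (l : nat).
Hypotheses (Gu : u \in G) (l_pr : prime l) (l_r : (l %| r)%N).
Hypotheses (u_neq1 : u != 1%g) (ul1 : (u ^+ l)%g = 1%g).

Let l_coprime : coprime l (q * (q ^ 2 - 1)) := coprime_dvdl l_r r_coprime.

Lemma coprime_stabB : coprime l #|stabB q e|.
Proof.
rewrite prime_coprime //; apply/negP=> lB.
have [b [Bb b1 bl]] := Cauchy_expg l_pr lB.
by move: b1; rewrite (isoB_coprime q_pp q_odd cF conjq (hyp0 q_pp q_odd cF ne) l_coprime Bb bl) eqxx.
Qed.

(** The two index formulas for [G] give [q ^ 2 * #|R| = (q + 1) * #|B|], and [l] is prime to both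
    factors on the right. *)
Lemma coprime_stabR : coprime l #|stabR F q|.
Proof.
have e1 : (q ^ 2 * #|stabR F q| = (q + 1) * #|stabB q e|)%N.
  have := card_stabB q_pp q_odd cF conjq ne.
  rewrite (card_stabR q_pp q_odd cF conjq) (cube_fact q_gt0).
  rewrite [(q ^ 2 * r)%N]mulnC [((q + 1) * r)%N]mulnC -!mulnA => /eqP.
  by rewrite eqn_pmul2l ?(ltnW r_gt1) // => /eqP.
have : coprime l (q ^ 2 * #|stabR F q|).
  rewrite e1 coprimeMr coprime_stabB andbT.
  apply: coprime_dvdr l_coprime; rewrite dvdn_mull //.
  by apply/dvdnP; exists (q - 1)%N; rewrite -{2}(exp1n 2) subn_sqr.
by rewrite coprimeMr => /andP[].
Qed.

(** An isotropic eigenvector would put [u] in a Borel subgroup; a nonisotropic one, rescaled and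
    moved to [e3], would put a conjugate of [u] in [stabR]. Neither group has elements of order
    [l]. *)
Lemma no_eigenvector v a : v != 0 -> vact v u <> a *: v.
Proof.
move=> v0 vu.
have [vv|vv] := eqVneq (h v v) 0.
  have [y hy] := hyp_partner q_pp q_odd cF conjq vv v0.
  have Bu : u \in isoB q v by rewrite inE Gu; apply/lineP; exists a.
  by move: u_neq1; rewrite (isoB_coprime q_pp q_odd cF conjq hy l_coprime Bu ul1) eqxx.
have [t tE] := nrm_surj q_odd cF conjq (esym (herm_conj conjK v v)).
have t0 : t != 0 by rewrite -(nrm_eq0 conjq) tE.
have tv : h (t^-1 *: v) (t^-1 *: v) = 1.
  by rewrite hermZl hermZr -tE /nrm fmorphV; field; rewrite fmorph_eq0 t0.
have [g Gg gE] := unit_transitive q_pp q_odd cF conjq tv.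
have [w [Gw w1 wl wg]] := conjg_prime_order Gu Gg u_neq1 ul1.
have Rw : w \in stabR F q.
  rewrite inE Gw; apply/lineP; exists a; apply: (@vact_inj _ g).
  by rewrite -vactM wg vactM gE !vactZ vu gE !scalerA mulrC.
have lR := prime_dvd_cardG l_pr Rw w1 wl.
by move: coprime_stabR; rewrite prime_coprime // lR.
Qed.

Let U : 'M[F]_3 := GLval u.
Let chi := char_poly U.

Lemma size_chi : size chi = 4.
Proof. exact: size_char_poly. Qed.

Lemma chi_irreducible : irreducible_poly chi.
Proof.
apply: cubic_irreducible; first by rewrite size_chi.
move=> x; rewrite -eigenvalue_root_char; apply/eigenvalueP=> -[v vU v0].
exact: no_eigenvector v0 vU.
Qed.

(** A Bezout relation between [f] and the irreducible cubic [chi], evaluated at [U], inverts [f(U)]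
    by Cayley-Hamilton. *)
Lemma horner_unit (f : {poly F}) : f != 0 -> (size f <= 3)%N ->
  horner_mx U f \in unitmx.
Proof.
move=> f0 sf; have cop : coprimep f chi.
  rewrite coprimep_def; apply: contraTT sf => sg.
  have := chi_irreducible.2 _ sg (dvdp_gcdr _ _) => /eqp_size eg.
  by rewrite -ltnNge; apply: leq_trans (leq_gcdpl chi f0); rewrite eg size_chi.
have /Bezout_eq1_coprimepP[[a b] /= ab] := cop.
have : horner_mx U (a * f + b * chi) = 1 by rewrite ab rmorph1.
rewrite rmorphD !rmorphM /= Cayley_Hamilton mulr0 addr0 => ab1.
by have [] := mulmx1_unit ab1.
Qed.

(* The field F[u], realised inside the ring of matrices. *)
Definition Fu : {set 'M[F]_3} := [set horner_mx U (rVpoly v) | v : 'rV[F]_3].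

Lemma FuP A : reflect (exists f, A = horner_mx U f) (A \in Fu).
Proof.
apply: (iffP imsetP) => [[v _ ->]|[f ->]]; first by exists (rVpoly v).
exists (poly_rV (f %% chi)) => //; rewrite poly_rV_K.
  by rewrite [in LHS](divp_eq f chi) rmorphD rmorphM /= Cayley_Hamilton mulr0 add0r.
have : (size (f %% chi)%R < size chi)%N by rewrite ltn_modp irredp_neq0 //; apply: chi_irreducible.
by rewrite size_chi.
Qed.

Lemma FuD A B : A \in Fu -> B \in Fu -> A + B \in Fu.
Proof. by move=> /FuP[f ->] /FuP[g ->]; apply/FuP; exists (f + g); rewrite rmorphD. Qed.

Lemma FuM A B : A \in Fu -> B \in Fu -> A *m B \in Fu.
Proof. by move=> /FuP[f ->] /FuP[g ->]; apply/FuP; exists (f * g); rewrite rmorphM. Qed.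

Lemma FuC A B : A \in Fu -> B \in Fu -> A *m B = B *m A.
Proof.
by move=> /FuP[f ->] /FuP[g ->]; rewrite -!/(_ * _) -!rmorphM mulrC.
Qed.

Lemma Fu_scalar a : a%:M \in Fu.
Proof. by apply/FuP; exists a%:P; rewrite horner_mx_C. Qed.

Lemma FuZ a A : A \in Fu -> a *: A \in Fu.
Proof. by move=> FA; rewrite -mul_scalar_mx FuM ?Fu_scalar. Qed.

Lemma Fu_unit A : A \in Fu -> A != 0 -> A \in unitmx.
Proof.
case/imsetP=> v _ -> A0; apply: horner_unit; last exact: size_poly.
by apply: contraNneq A0 => ->; rewrite rmorph0.
Qed.

(** The adjoint of the unitary [U] is its inverse [U ^+ l.-1], again a polynomial in [U]. *)
Lemma Fu_ctrmx A : A \in Fu -> ctrmx A \in Fu.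
Proof.
case/FuP=> f ->; elim/poly_ind: f => [|f c IH].
  rewrite rmorph0 (_ : ctrmx 0 = 0%:M) ?Fu_scalar //.
  by apply/matrixP=> i j; rewrite !mxE rmorph0 mul0rn.
have -> : ctrmx (horner_mx U (f * 'X + c%:P)) = ctrmx U *m ctrmx (horner_mx U f) + (conj c)%:M.
  rewrite rmorphD rmorphM /= horner_mx_X horner_mx_C -ctrmxM.
  by apply/matrixP=> i j; rewrite !mxE rmorphD rmorphMn eq_sym.
apply: FuD (Fu_scalar _); apply: FuM IH.
have -> : ctrmx U = U ^+ l.-1.
  have := Gu; rewrite SU3E => /andP[/eqP UU _].
  have Ul : U *m U ^+ l.-1 = 1%:M.
    have -> : U ^+ l.-1 = GLval (u ^+ l.-1)%g.
      by elim: (l.-1) => [|n IHn]; rewrite ?expr0 ?expg0 // exprS expgS GL_ME IHn.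
    have -> : U *m GLval (u ^+ l.-1)%g = GLval (u * u ^+ l.-1)%g by rewrite GL_ME.
    by rewrite -expgS (prednK (prime_gt0 l_pr)) ul1 GL_1E.
  by rewrite -[LHS]mul1mx -(mulmx1C Ul) -mulmxA UU mulmx1.
by apply/FuP; exists ('X^(l.-1)); rewrite rmorphXn /= horner_mx_X.
Qed.

Lemma card_Fu : #|Fu| = (q ^ 6)%N.
Proof.
rewrite card_imset ?card_mx ?cF -?expnM // => v w evw.
apply/eqP; rewrite -subr_eq0; apply: contraT => vw0.
have h0 : horner_mx U (rVpoly (v - w)) = 0 by rewrite !raddfB /= evw subrr.
have p0 : rVpoly (v - w) != 0.
  by apply: contra vw0 => /eqP p0; rewrite -[v - w]rVpolyK p0 linear0.
by have := horner_unit p0 (size_poly _ _); rewrite h0 unitr0.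
Qed.

Definition selfadj : {set 'M[F]_3} := [set A in Fu | ctrmx A == A].

Lemma ctrmxD A B : ctrmx (A + B) = ctrmx A + ctrmx B.
Proof. by apply/matrixP=> i j; rewrite !mxE rmorphD. Qed.

Lemma ctrmxZ a A : ctrmx (a *: A) = conj a *: ctrmx A.
Proof. by apply/matrixP=> i j; rewrite !mxE rmorphM. Qed.

(** For a skew scalar [d], each element of the field is uniquely [A + d *: B] with [A] and [B]
    self-adjoint, so [#|selfadj|] squared is [q ^ 6]. *)
Lemma card_selfadj : #|selfadj| = (q ^ 3)%N.
Proof.
have [d d0 cd] := exists_skew q_odd cF conjq.
suff : #|setX selfadj selfadj| = #|Fu|.
  rewrite cardsX card_Fu (expnM q 3 2) -mulnn => /eqP.
  by rewrite !mulnn eqn_exp2r // => /eqP.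
pose f (AB : 'M[F]_3 * 'M[F]_3) := AB.1 + d *: AB.2.
have half (A B : 'M[F]_3) : A + A = B + B -> A = B.
  by rewrite -!mulr2n -!scaler_nat => /(scalerI n2).
rewrite -(card_in_imset (f := f)); last first.
  have sP M : M \in selfadj -> ctrmx M = M by rewrite inE => /andP[_ /eqP].
  move=> [A B] [A' B'] /setXP[/= /sP sA /sP sB] /setXP[/= /sP sA' /sP sB'].
  rewrite /f /= => e1.
  have := congr1 ctrmx e1; rewrite !ctrmxD !ctrmxZ sA sB sA' sB' cd => e2.
  have eA : A = A'.
    apply: half; have := congr2 +%R e1 e2.
    by rewrite !scaleNr addrACA subrr addr0 addrACA subrr addr0.
  by move: e1; rewrite eA => /addrI/(scalerI d0)->.
apply: eq_card => M; apply/imsetP/idP => [[[A B] /setXP[] /=]|FM].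
  by rewrite 2!inE => /andP[FA _] /andP[FB _] ->; rewrite FuD ?FuZ.
have i2 : conj 2%:R^-1 = 2%:R^-1 by rewrite fmorphV rmorph_nat.
exists (2%:R^-1 *: (M + ctrmx M), (2%:R^-1 * d^-1) *: (M - ctrmx M)).
  have FcM := Fu_ctrmx FM; have NcM : - ctrmx M \in Fu by rewrite -scaleN1r FuZ.
  apply/setXP; rewrite !inE /= !FuZ ?FuD //= !ctrmxZ i2; split.
    by rewrite ctrmxD ctrmxK // addrC.
  rewrite ctrmxD -scaleN1r ctrmxZ ctrmxK // rmorphN1 !scaleN1r rmorphM i2 fmorphV cd.
  by rewrite invrN mulrN scaleNr -scalerN opprD opprK addrC.
rewrite /f /= scalerA mulrCA divff // mulr1 -scalerDr.
rewrite addrACA subrr addr0 -mulr2n -scaler_nat scalerA mulVf ?scale1r //.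
Qed.

(** A common prime divides [q ^ 3 + 1] and [q ^ 3 - 1], hence 2, but [r] is odd. *)
Lemma coprime_r_q3 : coprime r (q ^ 3 - 1).
Proof.
rewrite /coprime eqn_leq gcdn_gt0 (ltnW r_gt1) andbT leqNgt; apply/negP=> gt1.
have := pdiv_dvd (gcdn r (q ^ 3 - 1)); have := pdiv_prime gt1.
move: (pdiv _) => s s_pr; rewrite dvdn_gcd => /andP[sr sq].
have s2 : (s %| 2)%N.
  have q3 : (0 < q ^ 3)%N by rewrite expn_gt0 q_gt0.
  have -> : (2 = (q + 1) * r - (q ^ 3 - 1))%N.
    by rewrite -(cube_fact q_gt0); move: (q ^ 3)%N q3 => n; clear; lia.
  by rewrite dvdn_sub // dvdn_mull.
have s_2 : s = 2 by apply/eqP; rewrite -(dvdn_prime2 s_pr).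
move: sr; rewrite s_2 dvdn2 oddD oddB ?oddX /= ?q_odd //.
by rewrite -{1}[q]expn1 leq_pexp2l.
Qed.

Definition Eu : {set {'GL_3[F]}} :=
  [set g : {'GL_3[F]} | (GLval g : 'M_3) \in Fu].

Lemma Eu_group_set : group_set Eu.
Proof.
apply/group_setP; split=> [|g g']; rewrite !inE.
  by rewrite GL_1E; apply: (Fu_scalar 1).
by move=> Fg Fg'; rewrite GL_ME; apply: FuM.
Qed.
Canonical Eu_group := Group Eu_group_set.

Lemma Fu_lift A : A \in Fu -> A != 0 -> exists2 g : {'GL_3[F]}, g \in Eu & GLval g = A.
Proof.
move=> FA A0; have uA : (A : 'M_3.-1.+1) \is a GRing.unit by apply: Fu_unit.
by exists (FinRing.unit _ uA); rewrite ?inE.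
Qed.

Lemma GLval_neq0 (g : {'GL_3[F]}) : (GLval g : 'M_3) != 0.
Proof. by apply: contraNneq (GL_det g) => ->; rewrite det0. Qed.

Lemma GLval_inj : injective (fun g : {'GL_3[F]} => GLval g).
Proof. by move=> g g' e1; apply: val_inj. Qed.

Lemma card_lift (H : {set {'GL_3[F]}}) (T : {set 'M[F]_3}) :
    (forall g, (g \in H) = ((GLval g : 'M_3) \in T)) -> T \subset Fu -> 0 \in T ->
  #|H| = #|T|.-1.
Proof.
move=> HT TF T0; rewrite (cardsD1 0 T) T0 /= -(card_imset _ GLval_inj).
apply: eq_card => A; apply/imsetP/setD1P => [[g Hg ->]|[A0 TA]].
  by rewrite GLval_neq0 -HT.
have [g _ gA] := Fu_lift (subsetP TF _ TA) A0.
by exists g; rewrite // HT gA.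
Qed.

Lemma Fu0 : 0 \in Fu.
Proof. by have := Fu_scalar 0; rewrite raddf0. Qed.

Definition E0 : {set {'GL_3[F]}} :=
  [set g : {'GL_3[F]} | (GLval g : 'M_3) \in selfadj].

Lemma E0_group_set : group_set E0.
Proof.
apply/group_setP; split=> [|g g']; rewrite !inE.
  by rewrite GL_1E -[1]/(1%:M) ctrmx1 eqxx (Fu_scalar 1).
move=> /andP[Fg /eqP sg] /andP[Fg' /eqP sg'].
by rewrite GL_ME FuM //= ctrmxM sg sg' FuC.
Qed.
Canonical E0_group := Group E0_group_set.

Lemma card_Eu : #|Eu| = (r * ((q + 1) * (q ^ 3 - 1)))%N.
Proof.
rewrite (@card_lift _ Fu) ?Fu0 //; last by move=> g; rewrite inE.
rewrite card_Fu mulnA [(r * _)%N]mulnC -(cube_fact q_gt0).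
have q3 : (0 < q ^ 3)%N by rewrite expn_gt0 q_gt0.
by rewrite (expnM q 3 2); move: (q ^ 3)%N q3 => n n0; nia.
Qed.

Lemma card_E0 : #|E0| = (q ^ 3 - 1)%N.
Proof.
rewrite (@card_lift _ selfadj) ?card_selfadj ?subn1 //; first by move=> g; rewrite inE.
  by apply/subsetP=> A; rewrite inE => /andP[].
by rewrite inE Fu0; apply/eqP/matrixP=> i j; rewrite !mxE rmorph0.
Qed.

Lemma Eu_abelian : abelian Eu.
Proof.
apply/centsP=> g; rewrite inE => Fg g'; rewrite inE => Fg'.
by apply: GLval_inj; apply: (FuC Fg Fg').
Qed.

(** [C] is the Hall subgroup of [Eu] for the primes of [r]; it has order [r] because [#|Eu|] is [r]
    times a number prime to [r]. *)
Lemma singer_subgroup : exists C : {group {'GL_3[F]}},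
  [/\ C \subset G, abelian C & #|C| = r].
Proof.
have hC := nilpotent_pcore_Hall \pi(r) (abelian_nil Eu_abelian).
pose C := 'O_\pi(r)(Eu_group)%G.
have sCE : C \subset Eu := pcore_sub _ _.
have r0 := ltnW r_gt1.
have cC : #|C| = r.
  have m0 : (0 < (q + 1) * (q ^ 3 - 1))%N.
    have := cardG_gt0 Eu_group; rewrite /= card_Eu muln_gt0 => /andP[_ //].
  rewrite (card_Hall hC) /= card_Eu partnM // part_pnat_id ?pnat_pi // part_p'nat ?muln1 //.
  rewrite -coprime_pi' // coprimeMr coprime_r_q3 andbT.
  apply: (coprime_dvdr _ r_coprime); rewrite dvdn_mull //.
  by apply/dvdnP; exists (q - 1)%N; rewrite -{2}(exp1n 2) subn_sqr.
exists C; split=> //; last exact: abelianS Eu_abelian.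
apply/subsetP=> g Cg; have Eg := subsetP sCE _ Cg.
have gr : (g ^+ r = 1)%g by rewrite -cC expg_cardG.
have Fg : GLval g \in Fu by rewrite inE in Eg.
have cg0 : ctrmx (GLval g) != 0.
  apply: contra (GLval_neq0 g) => /eqP c0; rewrite -[GLval g](ctrmxK conjK) c0.
  by apply/eqP/matrixP=> i j; rewrite !mxE rmorph0.
have [g' Eg' gg'] := Fu_lift (Fu_ctrmx Fg) cg0.
have powE k x : GLval (x ^+ k)%g = GLval x ^+ k.
  by elim: k => [|k IH]; rewrite ?expg0 ?expr0 ?GL_1E // expgS exprS GL_ME IH.
have gr' : (g' ^+ r = 1)%g.
  have e1 : GLval (g' ^+ r)%g = GLval (1 : {'GL_3[F]})%g; last exact: GLval_inj e1.
  rewrite powE gg' GL_1E.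
  have -> k : ctrmx (GLval g) ^+ k = ctrmx (GLval g ^+ k).
    elim: k => [|k IH]; first by rewrite !expr0 -[1]/(1%:M) ctrmx1.
    by rewrite exprS IH exprSr -!/(_ *m _) ctrmxM.
  by rewrite -powE gr GL_1E -[1]/(1%:M) ctrmx1.
have cgg' : commute g g' by apply: (centsP Eu_abelian).
(* The product of [g] and its adjoint is self-adjoint, in a group of order [q ^ 3 - 1] prime to [r],
   and its [r]-th power is 1; so it is 1 and [g] is unitary. *)
have E0g : (g * g')%g \in E0_group.
  rewrite !inE GL_ME gg' FuM ?Fu_ctrmx //=.
  by rewrite -[X in ctrmx X]/(_ *m _) ctrmxM ctrmxK.
have gg1 : (g * g' = 1)%g.
  apply: (expg_coprime_eq1 _ E0g (n := r)); first by rewrite /= card_E0 coprime_r_q3.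
  by rewrite expgMn // gr gr' mulg1.
rewrite SU3E /SU -gg' -[X in X == _]/(GLval g * GLval g') -GL_ME gg1 GL_1E eqxx /=.
apply/eqP; apply: (expr_coprime_eq1 (m := r) (n := q ^ 2 - 1)).
- by move: r_coprime; rewrite coprimeMr => /andP[].
- have dE k : \det (GLval (g ^+ k)%g) = \det (GLval g) ^+ k.
    elim: k => [|k IH]; first exact: det1.
    by rewrite expgS exprS -IH -det_mulmx.
  by rewrite -dE gr; apply: det1.
- apply: (expr_unit q_odd cF).
  by have := GL_det g; apply: contra => /eqP dg; apply/eqP.
Qed.

End IrreducibleElement.

End Singer.

Local Close Scope ring_scope.

(** * The two signatures *)

Local Open Scope group_scope.

Lemma card_mulg_inj (gT : finGroupType) (H : {group gT}) (S : {set gT}) y y' :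
    #|H * S| = (#|H| * #|S|)%N -> y \in S -> y' \in S -> y' * y^-1 \in H -> y = y'.
Proof.
rewrite mulg_imset -cardsX => cHS Sy Sy' Hy.
have /imset_injP inj : #|[set u.1 * u.2 | u in setX H S]| == #|setX H S| by rewrite cHS.
have := inj (y' * y^-1, y) (1, y'); rewrite !inE /= Hy group1 Sy Sy' mulgVK mul1g.
by move=> /(_ isT isT erefl)[].
Qed.

Section Signatures.
Variables (F : finFieldType) (q : nat) (conj : {rmorphism F -> F}).
Hypothesis q_pp : exists p k : nat, [/\ prime p, (0 < k)%N & q = (p ^ k)%N].
Hypotheses (q_odd : odd q) (cF : #|F| = (q ^ 2)%N) (conjq : forall x, conj x = (x ^+ q)%R).
Let conjK := conj_involutive cF conjq.
Local Notation G := (SU3 F q).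
Local Notation h := (herm conj).
Local Notation r := (q ^ 2 - q + 1)%N.
Variable e : F.
Hypothesis ne : nrm conj e = (- 1)%R.
Local Notation B := (stabB q e).
Local Notation B0 := (stabB0 q e).
Local Notation R := (stabR F q).
Local Notation D := (torusD F q).
Let hyp := hyp0 q_pp q_odd cF ne.
Let x := x0 e.
Let y := y0 e.
Local Notation Q := (isoQ q (x0 e)).
Local Notation Z := (isoZ q conj (x0 e) (y0 e)).

Let B_solvable : solvable B := isoB_solvable cF conjq hyp.
Let B_sub : B \subset G. Proof. exact: subsetIl. Qed.

Lemma center_prime_fact (H : {group {'GL_3[F]}}) :
  'Z(G) \subset H -> H \subset B -> prime_fact G 'Z(G) H.
Proof.
move=> ZH HB; have HG := subset_trans HB B_sub.
apply: (prime_fact_solvable HG (solvableS HB B_solvable)).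
exact: normalS ZH HG (center_normal G).
Qed.

Lemma subgroup_prime_fact (T : {set {'GL_3[F]}}) (H : {group {'GL_3[F]}}) :
    H \subset G -> solvable H -> #|(T * H)%g| = (#|T| * #|H|)%N ->
  prime_fact G T (T * H).
Proof.
move=> HG solH cTH; apply: (@prime_fact_mul _ _ _ 1%G); rewrite ?mulg1 ?cards1 ?muln1 //.
exact: prime_fact_solvable HG solH (normal1 H).
Qed.

Lemma stabR_prime_fact : prime_fact G B0 R.
Proof.
have [R_eq tiBD] := stabR_fact q_pp q_odd cF conjq ne.
rewrite -R_eq; apply: subgroup_prime_fact.
- by apply/subsetP=> g /setIP[/setIP[/setIP[Gg _] _] _].
- exact: torusD_solvable.
- exact: TI_cardMg.
Qed.

Lemma PSU3_has_MLS_of_prime : prime r -> has_MLS (PSU3 F q).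
Proof.
move=> r_pr; have ZQ := isoZ_normal cF conjq hyp.
have R_sub : R \subset G by apply: subsetIl.
have Q_sub : Q \subset G by apply: subsetIl.
have RQ g : g \in G -> R :^ g :&: Q \subset Z.
  move=> Gg; apply/subsetP=> _ /setIP[/imsetP[k /setIP[Gk /lineP[a ka]] ->] Qk].
  have eg : h (vact (e3 F) g) (vact (e3 F) g) = 1%R.
    by rewrite (vact_herm cF conjq) // herm_e3.
  apply: (nonisotropic_isoQ cF conjq hyp eg Qk); apply/lineP; exists a.
  by rewrite conjgE -vactM mulKVg vactM ka vactZ.
have [S [SG cRS RSZ RSQ cG]] := double_coset_transversal R_sub Q_sub (normal_sub ZQ) RQ.
(* Compare [#|R| * #|S| * #|Q| = #|G| * #|Z|] with [#|Q| = q ^ 2 * #|Z|] and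
   [#|G| = q ^ 2 * r * #|R|]. *)
have cS : #|S| = r.
  have := cG; rewrite cRS (card_stabR q_pp q_odd cF conjq) (card_isoQ q_pp q_odd cF conjq hyp).
  have := cardG_gt0 R; have := cardG_gt0 Z; have := odd_gt0 q_odd.
  move: #|R| #|Z| #|S| r => cR cZ cS' r' q0 Z0 R0 /eqP.
  rewrite [X in X == _](_ : _ = cR * cZ * q ^ 2 * cS')%N; last by ring.
  rewrite [X in _ == X](_ : _ = cR * cZ * q ^ 2 * r')%N; last by ring.
  by rewrite eqn_pmul2l ?muln_gt0 ?R0 ?Z0 ?expn_gt0 ?q0 // => /eqP.
have [_ ZB0] := center_sub_stab q_pp q_odd cF conjq e.
have QB : Q \subset B.
  apply/subsetP=> g /setIP[Gg /stab1P xg]; rewrite inE Gg; apply/lineP.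
  by exists 1%R; rewrite scale1r.
(* The chain of factorizations is ['Z(G)], [B0], [R], [R * S], [R * S * Q = G]. *)
apply: quotient_has_MLS; first exact: center_normal.
apply: prime_fact_trans (center_prime_fact ZB0 _) _.
  by apply/subsetP=> g /setIP[/setIP[Gg _] gx]; rewrite inE Gg.
apply: prime_fact_trans stabR_prime_fact _.
apply: (prime_fact_trans (H := R * S)); first by apply: prime_fact1; rewrite ?cRS // cS.
rewrite -[in X in prime_fact _ _ X]RSQ; apply: (prime_fact_mul (Z := Z)) => //.
- by rewrite RSQ.
- exact: prime_fact_solvable Q_sub (solvableS QB B_solvable) ZQ.
Qed.

(* Two distinct isotropic points <x y1>, <x y2> are the images of <x>, <y> under
   a single element, by transitivity on hyperbolic pairs. *)
Lemma cosets_two_transitive s g g' : s \in G -> vact x s = y ->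
    g \in G -> g' \in G -> g' * g^-1 \notin B ->
  exists2 a, a \in G & B * [set 1; s] * [set a] = B * [set g; g'].
Proof.
move=> Gs xs Gg Gg' nB; have [xx yy xy] := hyp.
pose u := vact x g; pose v := vact x g'.
have uu : h u u = 0%R by rewrite (vact_herm cF conjq).
have vv : h v v = 0%R by rewrite (vact_herm cF conjq).
have uv : h u v != 0%R.
  apply: (isotropic_pair q_pp q_odd cF conjq uu vv); first by rewrite vact_eq0 x0_neq0.
  move=> b; apply: contra nB => /eqP vb; rewrite inE groupM ?groupV //; apply/lineP; exists b.
  by rewrite vactM -/v vb vactZ -vactM mulgV vact1.
pose c := (h u v)^-1%R.
have huv : hyperbolic conj u (conj c *: v)%R.
  by split; rewrite // ?hermZl hermZr ?vv ?mulr0 // conjK mulVf.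
have [a [Ga xa ya]] := vact_hyp_transitive cF conjq hyp huv.
exists a => //; rewrite mulgU mulUg [RHS]mulgU mulg1; congr (_ :|: _).
  apply: rcoset_eqP; rewrite mem_rcoset inE groupM ?groupV //; apply/lineP; exists 1%R.
  by rewrite vactM xa -vactM mulgV vact1 scale1r.
have e1 : vact x (s * a * g'^-1) = (conj c *: x)%R.
  by rewrite !vactM xs ya vactZ -vactM mulgV vact1.
rewrite -mulgA mulg_set1; apply: rcoset_eqP; rewrite mem_rcoset.
apply/setIP; split; first by rewrite !groupM ?groupV.
by apply/lineP; exists (conj c).
Qed.

Lemma PSU3_has_MLS_of_half_prime (p : nat) :
    prime p -> q.+1 = (2 * p)%N -> (5 < q)%N -> has_MLS (PSU3 F q).
Proof.
move=> p_pr q2p q5; have [xx yy xy] := hyp.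
have q0 := odd_gt0 q_odd.
(* Since [r = (q - 2) * (q + 1) + 3], only 3 can be a common prime of [r] and [q + 1 = 2 * p]; that
   would mean [p = 3] and [q = 5]. *)
have q3 : coprime 3 (q + 1).
  rewrite addn1 q2p coprimeMr /= prime_coprime // dvdn_prime2 //.
  by apply/eqP=> p3; move: q5 q2p; rewrite -p3; clear; lia.
have r_cop : coprime r (q * (q ^ 2 - 1)).
  have -> : (q ^ 2 - 1 = (q - 1) * (q + 1))%N by rewrite -subn_sqr exp1n.
  rewrite !coprimeMr ![coprime r _]coprime_sym.
  have -> : coprime q r.
    rewrite (_ : r = (q - 1) * q + 1)%N; last by move: q5; clear; nia.
    by rewrite /coprime gcdnMDl gcdn1.
  have -> : coprime (q - 1) r.
    rewrite (_ : r = q * (q - 1) + 1)%N; last by move: q5; clear; nia.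
    by rewrite /coprime gcdnMDl gcdn1.
  rewrite (_ : r = (q - 2) * (q + 1) + 3)%N; last by move: q5; clear; nia.
  by rewrite /coprime gcdnMDl gcdnC.
have r_gt1 : (1 < r)%N by move: q5; clear; nia.
have G_r : (r %| #|G|)%N.
  by rewrite (card_stabR q_pp q_odd cF conjq) -mulnA dvdn_mull // dvdn_mulr.
have l_pr := pdiv_prime r_gt1; have l_r := pdiv_dvd r.
have [u [Gu u1 ul]] := Cauchy_expg l_pr (dvdn_trans l_r G_r).
have [C [CG abC cC]] := singer_subgroup q_pp q_odd cF conjq ne r_cop r_gt1 Gu l_pr l_r u1 ul.
(* [C] acts semiregularly on the isotropic points, so the double coset lemma applies with trivial
   [Z] and gives [G = B * S * C]. *)
have BC g : g \in G -> B :^ g :&: C \subset 1%G.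
  move=> Gg; apply/subsetP=> _ /setIP[/imsetP[k Bk ->] Ck].
  have kr : k ^+ r = 1.
    apply: (conjg_inj g); rewrite conjXg conj1g -cC; exact: expg_cardG.
  by rewrite (isoB_coprime q_pp q_odd cF conjq hyp r_cop Bk kr) conj1g inE.
have [S [SG cBS _ BSC cG]] := double_coset_transversal B_sub CG (sub1G C) BC.
have cS : #|S| = p.*2.
  move: cG; rewrite cBS cC cards1 muln1 (card_stabB q_pp q_odd cF conjq ne) (cube_fact q0).
  rewrite -mul2n -q2p -(addn1 q) => /eqP.
  rewrite [X in X == _](_ : _ = #|B| * r * #|S|)%N; last by ring.
  rewrite [X in _ == X](_ : _ = #|B| * r * (q + 1))%N; last by ring.
  by rewrite eqn_pmul2l ?muln_gt0 ?cardG_gt0 ?(ltnW r_gt1) // => /eqP.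
have y_neq0 : y != 0%R.
  apply/negP=> /eqP y0'; move: xy; rewrite -/y y0' => /eqP.
  by rewrite (herm_conj conjK) herm0l rmorph0 eq_sym oner_eq0.
have [s Gs xs] := isotropic_transitive q_pp q_odd cF conjq xx yy (x0_neq0 e) y_neq0.
pose P : {set {'GL_3[F]}} := [set 1; s].
have pairS g g' : g \in S -> g' \in S -> g != g' ->
    exists2 a, a \in G & B * P * [set a] = B * [set g; g'].
  move=> Sg Sg' ne_g; apply: cosets_two_transitive Gs xs (subsetP SG _ Sg) (subsetP SG _ Sg') _.
  by apply: contra ne_g => Bg; apply/eqP; apply: card_mulg_inj cBS Sg Sg' Bg.
have [A [AG cA BA]] := pair_cosets pairS cS.
(* The count [#|B| * 2p = #|B * P * A| <= #|B| * #|P| * #|A|], with [#|P| <= 2] and [#|A| <= p],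
   forces equality everywhere, so both blocks have prime size. *)
have cBD := card_mulg_le B P; have cBDA := card_mulg_le (B * P) A.
have cD : (#|P| <= 2)%N by rewrite cards2; case: (_ != _).
have B_gt0 := cardG_gt0 B.
rewrite BA cBS cS in cBDA.
have [cD2 [cAp cBD2]] : #|P| = 2 /\ #|A| = p /\ #|(B * P)%g| = (#|B| * 2)%N.
  move: B_gt0 cA cD cBD cBDA (prime_gt0 p_pr); rewrite -mul2n.
  move: #|B| #|P| #|A| #|(B * P)%g| => b d a m b0 ap d2 mbd le p0.
  have le2 : (2 * p <= d * a)%N.
    rewrite -(leq_pmul2l b0); apply: leq_trans le _.
    by rewrite mulnA leq_mul2r mbd orbT.
  have d_eq : d = 2 by move: d2 ap le2 p0; clear; case: d => [|[|[|d]]] //; lia.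
  have a_eq : a = p by move: ap le2; rewrite d_eq; clear; lia.
  do ![split] => //; apply/eqP; rewrite eqn_leq -{1}d_eq mbd /=.
  by rewrite -(leq_pmul2r p0) -{2}a_eq -mulnA.
have [ZB _] := center_sub_stab q_pp q_odd cF conjq e.
(* The chain of factorizations is ['Z(G)], [B], [B * P], [B * P * A = B * S], [B * S * C = G]. *)
apply: quotient_has_MLS; first exact: center_normal.
apply: prime_fact_trans (center_prime_fact ZB (subxx _)) _.
apply: (prime_fact_trans (H := B * P)).
  apply: prime_fact1; rewrite ?cD2 //.
  by apply/subsetP=> g /set2P[]->.
apply: (prime_fact_trans (H := B * S)).
  rewrite -BA; apply: prime_fact1; rewrite ?cAp //.
  by rewrite BA cBS cS cBD2 -mul2n mulnA.
rewrite -[in X in prime_fact _ _ X]BSC; apply: subgroup_prime_fact => //.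
  exact: abelian_sol.
by rewrite BSC cG cards1 muln1.
Qed.

End Signatures.

Local Close Scope group_scope.

Theorem theorem4p4 (q : nat) :
  (exists p k : nat, [/\ prime p, (0 < k)%N & q = p ^ k]) ->
  odd q ->
  forall F : finFieldType, #|F| = (q ^ 2)%N ->
  (prime (q ^ 2 - q + 1) -> has_MLS (PSU3 F q)) /\
  ((5 < q)%N -> (exists p : nat, prime p /\ q.+1 = (2 * p)%N) ->
     has_MLS (PSU3 F q)).
Proof.
move=> q_pp q_odd F cF; have [conj conjq] := frobq_rmorphism q_pp cF.
have [e ne] : exists e, nrm conj e = (- 1)%R.
  by apply: (nrm_surj q_odd cF conjq); rewrite rmorphN1.
split=> [r_pr|q5 [p [p_pr q2p]]].
  exact: (PSU3_has_MLS_of_prime q_pp q_odd cF conjq ne r_pr).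
exact: (PSU3_has_MLS_of_half_prime q_pp q_odd cF conjq ne p_pr q2p q5).
Qed.
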